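(* Let $f=a/d^{\,j}\in\mathbb K(t,\mathbf x)$ where $j\ge1$, $a\in\mathbb K(t,x_2,\dots,x_m)[x_1]$, $d\in\mathbb K[t,\mathbf x]$ is irreducible with $\deg_{x_1}(d)>0$, $\deg_{x_1}(a)<\deg_{x_1}(d)$, and $\operatorname{rank}(G_{t,d}/G_d)=1$. Let $\{\tau_0,\tau_1,\dots,\tau_r\}$ be a basis of $G_{t,d}$ such that $G_{t,d}/G_d$ is generated by the coset $\tau_0G_d$ and $\{\tau_1,\dots,\tau_r\}$ is a basis of $G_d$ (if $G_d=\{\mathbf 1\}$ take $r=1$, $\tau_1=\mathbf 1$). Then $f$ has a telescoper of type $(\sigma_t;\sigma_{x_1},\dots,\sigma_{x_n})$ if and only if there exists a nonzero operator $L=\sum_{i=0}^{\rho}\ell_iT_0^i$ with $\ell_i\in\mathbb K(t)$ such that $$L(a)=\Delta_{\tau_1}(b_1)+\cdots+\Delta_{\tau_r}(b_r)$$ for some $b_i\in\mathbb K(t,x_2,\dots,x_m)[x_1]$ with $\deg_{x_1}(b_i)<\deg_{x_1}(d)$, $1\le i\le r$. Here $L(a):=\sum_i\ell_i\,\tau_0^i(a)$.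
   Context: $\mathbb K$ is a field of characteristic zero, $\mathbf x=(x_1,\dots,x_m)$, $1\le n\le m$; $\sigma_t,\sigma_{x_i}$ are the $\mathbb K$-automorphisms of $\mathbb K(t,\mathbf x)$ shifting $t$, resp. $x_i$, by $1$ and fixing the other variables. $G=\langle\sigma_{x_1},\dots,\sigma_{x_n}\rangle$, $G_t=\langle\sigma_t,\sigma_{x_1},\dots,\sigma_{x_n}\rangle$ (free abelian under composition); $G_d=\{\tau\in G:\tau(d)=d\}$, $G_{t,d}=\{\tau\in G_t:\tau(d)=d\}$. For $\tau$ in $G_t$, $\Delta_\tau(g)=\tau(g)-g$. $T_0$ denotes the shift operator corresponding to $\tau_0$, i.e. if $\tau_0=\sigma_t^{k_0}\sigma_{x_1}^{k_1}\cdots\sigma_{x_n}^{k_n}$ then $T_0=S_t^{k_0}S_{x_1}^{k_1}\cdots S_{x_n}^{k_n}$, acting as $\tau_0$. A telescoper of type $(\sigma_t;\sigma_{x_1},\dots,\sigma_{x_n})$ for $f$ is a nonzero $L=\sum_\ell e_\ell S_t^\ell$, $e_\ell\in\mathbb K(t)$, such that $\sum_\ell e_\ell\sigma_t^\ell(f)=\sum_{i=1}^n\Delta_{\sigma_{x_i}}(g_i)$ for some $g_i\in\mathbb K(t,\mathbf x)$. *)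

(* Defs.v *)
From HB Require Import structures.
From mathcomp Require Import all_boot all_order all_algebra.
From mathcomp Require Import mpoly.

Set Implicit Arguments.
Unset Strict Implicit.
Unset Printing Implicit Defensive.

Import Order.TTheory GRing.Theory Num.Theory.
Local Open Scope ring_scope.

(* Variables of K[t,x_1,...,x_m] are indexed by 'I_(m.+1):
   index 0 is t, index i (1 <= i <= m) is x_i.
   An element tau = sigma_t^{k_0} sigma_{x_1}^{k_1} ... sigma_{x_n}^{k_n}
   of the free abelian group G_t is encoded by its exponent vector
   k : 'rV[int]_(n.+1) (composition of shifts = addition of vectors). *)

Section Shifts.
Variables (K : fieldType) (m n : nat).

Local Notation P := {mpoly K[m.+1]}.
Local Notation F := {fraction P}.

Definition shift_exp (k : 'rV[int]_(n.+1)) (i : 'I_(m.+1)) : int :=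
  if (i < n.+1)%N then k 0 (inord i) else 0.

Definition shiftP (k : 'rV[int]_(n.+1)) (p : P) : P :=
  p \mPo [tuple ('X_i + ((shift_exp k i)%:~R)%:MP) | i < m.+1].

Definition shiftF (k : 'rV[int]_(n.+1)) (f : F) : F :=
  (tofrac (shiftP k (repr f).1)) / (tofrac (shiftP k (repr f).2)).

Definition DeltaF (k : 'rV[int]_(n.+1)) (g : F) : F := shiftF k g - g.

Definition sigma_t : 'rV[int]_(n.+1) := delta_mx 0 0.
Definition sigma_x (i : 'I_n) : 'rV[int]_(n.+1) := delta_mx 0 (lift ord0 i).

(* G = <sigma_{x_1},...,sigma_{x_n}> : the t-exponent is 0 *)
Definition inG (k : 'rV[int]_(n.+1)) : Prop := k 0 0 = 0.
Definition inGtd (d : P) (k : 'rV[int]_(n.+1)) : Prop := shiftF k (tofrac d) = tofrac d.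
Definition inGd (d : P) (k : 'rV[int]_(n.+1)) : Prop := inG k /\ inGtd d k.

(* degree of a polynomial in the variable with index i (deg 0 = 0) *)
Definition degv (i : 'I_(m.+1)) (p : P) : nat := \max_(mm <- msupp p) mm i.

Definition ix1 : 'I_(m.+1) := inord 1.

Definition inKt (c : F) : Prop :=
  exists p q : P, [/\ q != 0,
    (forall i : 'I_(m.+1), i != ord0 -> degv i p = 0%N /\ degv i q = 0%N)
    & c = tofrac p / tofrac q].

Definition polyx1_deg_lt (N : nat) (a : F) : Prop :=
  exists p q : P, [/\ q != 0, degv ix1 q = 0%N, (degv ix1 p < N)%N
    & a = tofrac p / tofrac q].

Definition applyOp (k : 'rV[int]_(n.+1)) (c : seq F) (f : F) : F :=
  \sum_(i < size c) c`_i * shiftF (k *+ i) f.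

Definition is_telescoper (e : seq F) (f : F) : Prop :=
  [/\ (forall c, c \in e -> inKt c), has (fun c => c != 0) e &
      exists g : 'I_n -> F,
        applyOp sigma_t e f = \sum_(i < n) DeltaF (sigma_x i) (g i)].

Definition has_telescoper (f : F) : Prop := exists e, is_telescoper e f.

End Shifts.

Definition irreducible_elt (R : idomainType) (d : R) : Prop :=
  [/\ d != 0, d \isn't a GRing.unit &
      forall p q : R, d = p * q -> p \is a GRing.unit \/ q \is a GRing.unit].

Definition zcomb (n : nat) (S : seq 'rV[int]_n) (c : nat -> int) : 'rV[int]_n :=
  \sum_(i < size S) S`_i *~ c i.

Definition is_basis (n : nat) (S : seq 'rV[int]_n) (H : 'rV[int]_n -> Prop) : Prop :=
  [/\ forall i, (i < size S)%N -> H S`_i,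
      (forall c : nat -> int, zcomb S c = 0 -> forall i, (i < size S)%N -> c i = 0)
    & forall v, H v -> exists c, v = zcomb S c].

(* rank of the quotient H/K (K a subgroup of H) equals 1: there is an element
   of infinite order modulo K and any element is Z-dependent on it modulo K *)
Definition quot_rank1 (n : nat) (H K : 'rV[int]_n -> Prop) : Prop :=
  exists2 g, H g &
    (forall c : int, K (g *~ c) -> c = 0) /\
    (forall v, H v -> exists c : int, exists e : int, c != 0 /\ K (v *~ c - g *~ e)).

Arguments inGtd {K m} n d k.
Arguments inGd {K m} n d k.
Arguments has_telescoper {K m} n f.
Arguments is_telescoper {K m} n e f.

(* Main.v *)
(* Let W be the set of numerators (degree in x_1 below deg d) and O the local
   ring of rational functions without a pole along d.  Since d is prime and
   deg_{x_1} d > 0, O is the direct sum of W and d O, so every g has a d-adic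
   expansion with digits in W; let D g be the coefficient of d^-j.  It is
   additive, commutes with the stabiliser of d, vanishes on O, and
   D (w / d^j) = w.  Summing D (theta g) over theta in G modulo G_d gives an
   additive map Phi into W modulo U, with U = sum_i Delta_{tau_i} W, which is
   invariant under G and therefore kills every sum of Delta_{sigma_{x_i}}.

   Given a telescoper sum_l e_l S_t^l of f = a / d^j, translate it so that a
   nonzero coefficient sits at l = 0 and apply Phi: the terms with l not
   divisible by the t-exponent k_0 of tau_0 vanish, since then sigma_t^l d is
   not G-equivalent to d, and the term l = k_0 i contributes e_l tau_0^i(a).
   Conversely, dividing L(a) by d^j and replacing tau_0^i by sigma_t^(k_0 i),
   which changes the value only by differences, produces a telescoper.  In both
   directions the negative powers are removed by a further translation. *)

From Stdlib Require Import Classical ClassicalEpsilon.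
Require Import Defs.
From HB Require Import structures.
From mathcomp Require Import all_boot all_order all_algebra.
From mathcomp Require Import mpoly zify ring.

Set Implicit Arguments.
Unset Strict Implicit.
Unset Printing Implicit Defensive.

Import GRing.Theory Pdiv.Idomain.
Local Open Scope ring_scope.

(** * Irreducible polynomials are prime *)

Definition divides (R : comNzRingType) (p q : R) : Prop := exists c, q = p * c.

Definition prime_elt (R : idomainType) (p : R) : Prop :=
  [/\ p != 0, p \isn't a GRing.unit &
      forall a b, divides p (a * b) -> divides p a \/ divides p b].

(** Asking for prime rather than irreducible factors makes uniqueness of the factorization
    automatic. *)
Definition factorial_ring (R : idomainType) : Prop :=
  forall c : R, c != 0 -> exists u (s : seq R),
    [/\ u \is a GRing.unit, forall p, p \in s -> prime_elt p
      & c = u * \prod_(p <- s) p].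

Section Divides.
Variable R : comNzRingType.
Implicit Types p q r : R.

Lemma divides_refl p : divides p p.
Proof. by exists 1; rewrite mulr1. Qed.

Lemma divides0 p : divides p 0.
Proof. by exists 0; rewrite mulr0. Qed.

Lemma divides_mull p q r : divides p q -> divides p (r * q).
Proof. by move=> [c ->]; exists (r * c); rewrite mulrCA. Qed.

Lemma divides_mulr p q r : divides p q -> divides p (q * r).
Proof. by rewrite mulrC; apply: divides_mull. Qed.

Lemma dividesD p q r : divides p q -> divides p r -> divides p (q + r).
Proof. by move=> [c ->] [e ->]; exists (c + e); rewrite mulrDr. Qed.

Lemma dividesB p q r : divides p q -> divides p r -> divides p (q - r).
Proof. by move=> [c ->] [e ->]; exists (c - e); rewrite mulrBr. Qed.

End Divides.

Section PolyFactorial.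
Variable A : idomainType.
Implicit Types (p q g h d : {poly A}) (c : A).

(** The constant divides the product of the leading coefficients, hence one of them. Stripping that
    leading term keeps the product divisible and shortens a factor, so induction on the total size
    applies. *)
Lemma prime_polyC (c : A) : prime_elt c -> prime_elt c%:P.
Proof.
case=> c0 cU cP; split; first by rewrite polyC_eq0.
  by rewrite poly_unitE coefC eqxx (negPf cU) andbF.
move=> a b; have [k] := ubnP (size a + size b)%N.
elim: k a b => // k IH a b; rewrite ltnS => le_k [q abE].
have [->|a0] := eqVneq a 0; first by left; apply: divides0.
have [->|b0] := eqVneq b 0; first by right; apply: divides0.
have lead_tail p : p != 0 ->
    (size (p - (lead_coef p)%:P * 'X^((size p).-1))%R < size p)%N.
  move=> p0; have sp : (0 < size p)%N by rewrite size_poly_gt0.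
  rewrite -(prednK sp) ltnS; apply/leq_sizeP => i le_i.
  rewrite coefB coefCM coefXn; case: eqP => [->|/eqP ne_i].
    by rewrite mulr1 subrr.
  by rewrite mulr0 subr0 nth_default // -(prednK sp) ltn_neqAle eq_sym ne_i.
have : divides c (lead_coef a * lead_coef b).
  by rewrite -lead_coefM abE lead_coefM lead_coefC; eexists.
case/cP => -[l lE].
  have dvd_tail : divides c%:P ((lead_coef a)%:P * 'X^((size a).-1)).
    by rewrite lE polyCM -mulrA; eexists.
  case: (IH (a - (lead_coef a)%:P * 'X^((size a).-1)) b).
  - by apply: leq_trans le_k; rewrite ltn_add2r lead_tail.
  - rewrite mulrBl; apply: dividesB; first by exists q.
    exact: divides_mulr.
  - by move=> /dividesD/(_ dvd_tail); rewrite subrK; left.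
  - by right.
have dvd_tail : divides c%:P ((lead_coef b)%:P * 'X^((size b).-1)).
  by rewrite lE polyCM -mulrA; eexists.
case: (IH a (b - (lead_coef b)%:P * 'X^((size b).-1))).
- by apply: leq_trans le_k; rewrite ltn_add2l lead_tail.
- rewrite mulrBr; apply: dividesB; first by exists q.
  exact: divides_mull.
- by left.
- by move=> /dividesD/(_ dvd_tail); rewrite subrK; right.
Qed.

Hypothesis factA : factorial_ring A.

(* Gauss's lemma: the prime factors of c are cancelled one at a time. *)
Lemma cancel_polyC (c : A) (p g h : {poly A}) : c != 0 -> c%:P * p = g * h ->
  exists (a : A) (g' h' : {poly A}),
    [/\ p = g' * h', a != 0 & a%:P * g' = g].
Proof.
move=> c0; have [u [s [uU sP cE]]] := factA c0; subst c.
have us0 : u != 0 by apply: contraTneq uU => ->; rewrite unitr0.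
elim: s sP g h {c0} => [|c s IH] sP g h.
  (* The leftover unit is charged to the left factor. *)
  rewrite big_nil mulr1 => E; exists u, (u^-1%:P * g), h; split=> //.
    by rewrite -mulrA -E mulrA -polyCM mulVr // mul1r.
  by rewrite mulrA -polyCM divrr // mul1r.
have {}IH := IH (fun x xs => sP x (@mem_behead _ (c :: s) x xs)).
have [c0 cU cP] := prime_polyC (sP c (mem_head _ _)).
rewrite big_cons mulrCA polyCM -mulrA => E.
have : divides c%:P (g * h) by rewrite -E; eexists.
case/cP => -[l lE]; subst.
  move: E; rewrite -mulrA => /(mulfI c0) E.
  have [a [g' [h' [-> a0 <-]]]] := IH _ _ E.
  exists (c * a), g', h'; split=> //; last by rewrite polyCM mulrA.
  by rewrite mulf_neq0 // -polyC_eq0.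
move: E; rewrite [RHS]mulrCA => /(mulfI c0) E.
exact: IH E.
Qed.

Section Irreducible.
Variable d : {poly A}.
Hypotheses (d_irr : irreducible_elt d) (d_size : (1 < size d)%N).

(** Gauss's lemma gives [p = g * h] with [d = a * g] and [a] constant. If [a] is a unit, [d] divides
    [p]; if [g] is a unit, [d] has degree 0, which [d_size] excludes. *)
Lemma cancel_polyC_divides (c : A) (p : {poly A}) :
  c != 0 -> divides d (c%:P * p) -> divides d p.
Proof.
move=> c0 [q /(cancel_polyC c0)[a [g [h [-> a0 gE]]]]].
case: d_irr => _ _ /(_ _ _ (esym gE))[aU|gU].
  by exists ((a%:P)^-1 * h); rewrite -gE mulrACA divrr // mul1r.
move: d_size; rewrite -gE size_Cmul //.
by move: gU; rewrite poly_unitE => /andP[/eqP-> _].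
Qed.

(** This is Bezout over the fraction field of [A], with denominators cleared into [c]. If the gcd
    had positive degree, Gauss's lemma would turn it into a true factor of [d], hence an associate
    of [d], and [d] would divide [p]. *)
Lemma irreducible_poly_bezout (p : {poly A}) : ~ divides d p ->
  exists u v (c : A), c != 0 /\ c%:P = u * d + v * p.
Proof.
move=> ndp; have [cop|ncop] := boolP (coprimep d p).
  have /Bezout_coprimepP[[u v] /= /eqpP[[c1 c2] /= /andP[c10 c20] E]] := cop.
  exists (c1 *: u), (c1 *: v), c2; split=> //.
  by rewrite -!scalerAl -scalerDr E alg_polyC.
case: ndp; pose g := gcdp d p.
have /Pdiv.Idomain.dvdpP[[c e] /= c0] := dvdp_gcdl d p.
rewrite -mul_polyC mulrC mulrC [e * _]mulrC.
move=> /(cancel_polyC c0)[a [g' [e' [dE a0 gE]]]].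
have d0 : d != 0 by case: d_irr.
have sg : (1 < size g')%N.
  have : size g' != 1%N by rewrite -(size_Cmul g' a0) gE -coprimep_def.
  have : g' != 0 by apply: contraNneq d0 => g0; rewrite dE g0 mul0r.
  by rewrite -size_poly_gt0; case: size => [|[]].
case: d_irr => _ _ /(_ _ _ dE)[|eU].
  by rewrite poly_unitE => /andP[/eqP sg1]; rewrite sg1 in sg.
have /Pdiv.Idomain.dvdpP[[c2 e2] /= c20] := dvdp_gcdr d p.
rewrite -mul_polyC -gE => E.
apply: (@cancel_polyC_divides c2) => //; rewrite E dE.
exists (e'^-1 * (e2 * a%:P)); rewrite -mulrA mulVKr //.
by rewrite mulrA mulrC.
Qed.

(** Multiplying the Bezout relation of [d] and [g] by [h] makes [d] divide [c%:P * h], and the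
    constant cancels. *)
Lemma irreducible_poly_prime : prime_elt d.
Proof.
have [d0 dU _] := d_irr; split=> // g h dgh.
have [dg|ndg] := classic (divides d g); [by left | right].
have [u [v [c [c0 cE]]]] := irreducible_poly_bezout ndg.
apply: (cancel_polyC_divides c0); rewrite cE mulrDl; apply: dividesD.
  by apply/divides_mulr/divides_mull/divides_refl.
by rewrite -mulrA; apply: divides_mull.
Qed.

End Irreducible.
End PolyFactorial.

Lemma mpoly_rmorph_eq (n : nat) (R S : comNzRingType)
    (f g : {rmorphism {mpoly R[n]} -> S}) :
  (forall c, f c%:MP = g c%:MP) -> (forall i, f 'X_i = g 'X_i) -> f =1 g.
Proof.
move=> fgC fgX p; rewrite [p]mpolyE !rmorph_sum; apply: eq_bigr => m _.
rewrite -mul_mpolyC !rmorphM fgC; congr (_ * _).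
rewrite mpolyXE_id !rmorph_prod; apply: eq_bigr => i _.
by rewrite !rmorphXn /= fgX.
Qed.

(** * Multivariate polynomials as univariate polynomials in one chosen variable *)

Definition split_var (K : fieldType) (n : nat) (i j : 'I_n.+1) :
    {poly {mpoly K[n]}} :=
  if unlift i j is Some j' then ('X_j')%:P else 'X.

Definition mlift (K : fieldType) (n : nat) (i : 'I_n.+1) (c : {mpoly K[n]}) :
    {mpoly K[n.+1]} :=
  c \mPo [tuple 'X_(lift i j) | j < n].

HB.instance Definition _ (K : fieldType) (n : nat) (i : 'I_n.+1) :=
  GRing.RMorphism.copy (@mlift K n i)
    (comp_mpoly [tuple 'X_(lift i j) | j < n]).

(* Locked: unification must not unfold these isomorphisms. *)
HB.lock Definition to_poly (K : fieldType) (n : nat) (i : 'I_n.+1)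
    (p : {mpoly K[n.+1]}) : {poly {mpoly K[n]}} :=
  mmap (polyC \o @mpolyC n K) (@split_var K n i) p.

HB.lock Definition of_poly (K : fieldType) (n : nat) (i : 'I_n.+1)
    (q : {poly {mpoly K[n]}}) : {mpoly K[n.+1]} :=
  horner_eval 'X_i (map_poly (@mlift K n i) q).

Section Degree.
Variables (K : fieldType) (n : nat) (i : 'I_n.+1).
Implicit Types p q : {mpoly K[n.+1]}.

Lemma degv_leP p N :
  reflect (forall m : 'X_{1..n.+1}, m \in msupp p -> (m i <= N)%N)
          (degv i p <= N)%N.
Proof.
apply: (iffP idP) => [/bigmax_leqP_seq H m mp|H]; first exact: H.
by apply/bigmax_leqP_seq => m mp _; apply: H.
Qed.

Lemma degvD p q N :
  (degv i p <= N)%N -> (degv i q <= N)%N -> (degv i (p + q) <= N)%N.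
Proof.
move=> /degv_leP pN /degv_leP qN; apply/degv_leP => m /msuppD_le.
by rewrite mem_cat => /orP[/pN|/qN].
Qed.

Lemma degv_sum I (r : seq I) (P : pred I) (F : I -> {mpoly K[n.+1]}) N :
  (forall k, P k -> (degv i (F k) <= N)%N) ->
  (degv i (\sum_(k <- r | P k) F k) <= N)%N.
Proof.
move=> FN; apply: (big_ind (fun p => degv i p <= N)%N) => //.
  by rewrite /degv msupp0 big_nil.
by move=> p q; apply: degvD.
Qed.

Lemma degvM_le p q : (degv i (p * q) <= degv i p + degv i q)%N.
Proof.
apply/degv_leP => m /msuppM_le /allpairsP[[m1 m2] /= [pm1 qm2 ->]].
by rewrite mnmDE leq_add //; apply/degv_leP: (m1) pm1 || apply/degv_leP: qm2.
Qed.

Lemma degvC (c : K) : degv i c%:MP = 0%N.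
Proof.
apply/eqP; rewrite -leqn0; apply/degv_leP => m; rewrite msuppC.
by case: eqP => // _; rewrite inE => /eqP->; rewrite mnm0E.
Qed.

Lemma degvX (j : 'I_n.+1) : (degv i ('X_j : {mpoly K[n.+1]})%R <= (j == i))%N.
Proof.
by apply/degv_leP => m; rewrite msuppX inE => /eqP->; rewrite mnm1E.
Qed.

Lemma degv_exp_le p k : (degv i (p ^+ k) <= degv i p * k)%N.
Proof.
elim: k => [|k IH]; first by rewrite expr0 -mpolyC1 degvC.
rewrite exprS mulnS; apply: leq_trans (degvM_le _ _) _.
by rewrite leq_add2l.
Qed.

Lemma degv_prod_le I (r : seq I) (F : I -> {mpoly K[n.+1]}) :
  (degv i (\prod_(k <- r) F k) <= \sum_(k <- r) degv i (F k))%N.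
Proof.
elim: r => [|k r IH]; first by rewrite !big_nil -mpolyC1 degvC.
rewrite !big_cons; apply: leq_trans (degvM_le _ _) _.
by rewrite leq_add2l.
Qed.

Local Notation to_poly := (@to_poly K n i).
Local Notation of_poly := (@of_poly K n i).
Local Notation mlift := (@mlift K n i).

Lemma to_polyB : zmod_morphism to_poly.
Proof. by move=> p q; rewrite unlock rmorphB. Qed.

Lemma to_poly_monoid : monoid_morphism to_poly.
Proof. by split=> [|p q]; rewrite unlock ?rmorph1 ?rmorphM. Qed.

HB.instance Definition _ :=
  GRing.isZmodMorphism.Build {mpoly K[n.+1]} {poly {mpoly K[n]}} to_poly to_polyB.
HB.instance Definition _ :=
  GRing.isMonoidMorphism.Build {mpoly K[n.+1]} {poly {mpoly K[n]}} to_poly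
    to_poly_monoid.

Lemma of_polyB : zmod_morphism of_poly.
Proof. by move=> p q; rewrite unlock !rmorphB. Qed.

Lemma of_poly_monoid : monoid_morphism of_poly.
Proof. by split=> [|p q]; rewrite unlock ?rmorph1 ?rmorphM. Qed.

HB.instance Definition _ :=
  GRing.isZmodMorphism.Build {poly {mpoly K[n]}} {mpoly K[n.+1]} of_poly of_polyB.
HB.instance Definition _ :=
  GRing.isMonoidMorphism.Build {poly {mpoly K[n]}} {mpoly K[n.+1]} of_poly
    of_poly_monoid.

Lemma to_polyM : {morph to_poly : p q / p * q}.
Proof. exact: rmorphM. Qed.

Lemma to_poly1 : to_poly 1 = 1.
Proof. exact: rmorph1. Qed.

Lemma to_poly0 : to_poly 0 = 0.
Proof. exact: rmorph0. Qed.

Lemma of_polyM : {morph of_poly : p q / p * q}.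
Proof. exact: rmorphM. Qed.

Lemma of_polyD : {morph of_poly : p q / p + q}.
Proof. exact: rmorphD. Qed.

Lemma of_poly1 : of_poly 1 = 1.
Proof. exact: rmorph1. Qed.

Lemma of_poly0 : of_poly 0 = 0.
Proof. exact: rmorph0. Qed.

Lemma to_polyC (c : K) : to_poly c%:MP = (c%:MP)%:P.
Proof. by rewrite unlock mmapC. Qed.

Lemma to_polyX_self : to_poly 'X_i = 'X.
Proof. by rewrite unlock mmapX mmap1U /split_var unlift_none. Qed.

Lemma to_polyX_lift (j : 'I_n) : to_poly 'X_(lift i j) = ('X_j)%:P.
Proof. by rewrite unlock mmapX mmap1U /split_var liftK. Qed.

Lemma mliftX (j : 'I_n) : mlift 'X_j = 'X_(lift i j).
Proof. by rewrite /mlift comp_mpolyXU -tnth_nth tnth_mktuple. Qed.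

Lemma of_polyC c : of_poly c%:P = mlift c.
Proof. by rewrite unlock map_polyC /horner_eval hornerC. Qed.

Lemma of_polyX : of_poly 'X = 'X_i.
Proof. by rewrite unlock map_polyX /horner_eval hornerX. Qed.

Lemma to_polyK : cancel to_poly of_poly.
Proof.
apply: (@mpoly_rmorph_eq _ _ _ (of_poly \o to_poly) idfun) => [c|j] /=.
  by rewrite to_polyC of_polyC /mlift comp_mpolyC.
case: (unliftP i j) => [j'|] ->.
  by rewrite to_polyX_lift of_polyC mliftX.
by rewrite to_polyX_self of_polyX.
Qed.

Lemma to_poly_mlift c : to_poly (mlift c) = c%:P.
Proof.
apply: (@mpoly_rmorph_eq _ _ _ (to_poly \o mlift) polyC) => [e|j] /=.
  by rewrite /mlift comp_mpolyC to_polyC.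
by rewrite mliftX to_polyX_lift.
Qed.

Lemma of_polyK : cancel of_poly to_poly.
Proof.
elim/poly_ind => [|q c IH]; first by rewrite !rmorph0.
by rewrite !rmorphD !rmorphM /= IH of_polyX to_polyX_self of_polyC to_poly_mlift.
Qed.

Lemma degv_mlift c : degv i (mlift c) = 0%N.
Proof.
apply/eqP; rewrite -leqn0 /mlift comp_mpolyEX; apply: degv_sum => m _.
rewrite -mul_mpolyC; apply: leq_trans (degvM_le _ _) _; rewrite degvC add0n.
rewrite comp_mpolyX; apply: leq_trans (degv_prod_le _ _) _.
rewrite leqn0 sum_nat_eq0; apply/forallP => j /=; rewrite -leqn0.
apply: leq_trans (degv_exp_le _ _) _; rewrite tnth_mktuple.
by apply: leq_trans (leq_mul (degvX _) (leqnn _)) _; rewrite eq_sym (negPf (neq_lift _ _)).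
Qed.

Lemma degv_of_poly (q : {poly {mpoly K[n]}}) : (degv i (of_poly q) <= (size q).-1)%N.
Proof.
rewrite unlock /horner_eval (@horner_coef_wide _ (size q)); last exact: size_poly.
apply: degv_sum => k _; rewrite coef_map.
apply: leq_trans (degvM_le _ _) _; rewrite degv_mlift add0n.
apply: leq_trans (degv_exp_le _ _) _.
apply: leq_trans (leq_mul (degvX _) (leqnn _)) _; rewrite eqxx mul1n.
by rewrite -ltnS (leq_trans (ltn_ord k)) ?leqSpred.
Qed.

Lemma degv_size p : degv i p = (size (to_poly p)).-1.
Proof.
apply/eqP; rewrite eqn_leq -{1}[p]to_polyK degv_of_poly /=.
suff: (size (to_poly p) <= (degv i p).+1)%N by case: size.
rewrite {1}[p]mpolyE rmorph_sum big_seq.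
apply: (big_ind (fun q : {poly {mpoly K[n]}} => size q <= (degv i p).+1)%N) => [|q r sq sr|m mp].
- by rewrite size_poly0.
- by apply: leq_trans (size_polyD _ _) _; rewrite geq_max sq.
rewrite -mul_mpolyC rmorphM /= to_polyC mul_polyC.
apply: leq_trans (size_scale_leq _ _) _.
rewrite mpolyXE_id rmorph_prod (bigD1 i) //= rmorphXn /= to_polyX_self.
(* The factors in the other variables become constants; the 0 chosen at [j = i] is a dummy value. *)
have /all_sig[c cE] : forall j, {c | j != i -> to_poly ('X_j ^+ m j) = c%:P}.
  move=> j; case: (unliftP i j) => [j'|] ->; last by exists 0; rewrite eqxx.
  by exists ('X_j' ^+ m (lift i j')); rewrite rmorphXn /= to_polyX_lift polyC_exp.
rewrite (eq_bigr _ cE) -rmorph_prod mulrC mul_polyC.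
apply: leq_trans (size_scale_leq _ _) _; rewrite size_polyXn ltnS.
exact/(degv_leP p (degv i p)).
Qed.

Lemma to_poly_eq0 p : (to_poly p == 0) = (p == 0).
Proof.
apply/eqP/eqP => [E|->]; last exact: to_poly0.
by rewrite -[p]to_polyK E of_poly0.
Qed.

End Degree.

Lemma size_mul_pred (R : idomainType) (p q : {poly R}) :
  p != 0 -> q != 0 -> (size (p * q)).-1 = ((size p).-1 + (size q).-1)%N.
Proof.
move=> p0 q0; rewrite size_mul //; move: p0 q0; rewrite -!size_poly_gt0.
by case: (size p) => // k _; case: (size q) => // l _; rewrite addSn addnS.
Qed.

(** * Factoriality of polynomial rings over a field, and division by [d] *)

Section Factorial.
Variable K : fieldType.

Lemma mpoly_unit_msize (n : nat) (p : {mpoly K[n]}) :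
  (p \is a GRing.unit) = (msize p == 1%N).
Proof.
apply/idP/msize_poly1P => [/andP[/eqP pE pU]|[c c0 ->]].
  by exists p@_0 => //; apply: contraTneq pU => ->; rewrite unitr0.
by apply: (rmorph_unit (@mpolyC n K)); rewrite unitfE.
Qed.

(** Induction on the total degree: a reducible non-unit splits into two factors of smaller degree.
    The premise stays a hypothesis because it is itself proved by an induction that uses this step
    with one variable fewer. *)
Lemma mpoly_factorial_step (n : nat) :
  (forall d : {mpoly K[n]}, irreducible_elt d -> prime_elt d) ->
  factorial_ring {mpoly K[n]}.
Proof.
move=> irrP c; have [k] := ubnP (msize c); elim: k c => // k IH c le_k c0.
have [cU|cN] := boolP (c \is a GRing.unit).
  by exists c, [::]; rewrite big_nil mulr1.
have [c_irr|c_red] := classic (irreducible_elt c).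
  exists 1, [:: c]; split; rewrite ?unitr1 ?big_seq1 ?mul1r // => p.
  by rewrite inE => /eqP->; apply: irrP.
have [p [q [cE pN qN]]] : exists p q,
    [/\ c = p * q, p \isn't a GRing.unit & q \isn't a GRing.unit].
  apply: NNPP => H; apply: c_red; split=> // p q cE.
  have [|pN] := boolP (p \is a GRing.unit); first by left.
  have [|qN] := boolP (q \is a GRing.unit); first by right.
  by case: H; exists p, q.
have [p0 q0] : p != 0 /\ q != 0.
  by apply/andP; rewrite -negb_or -mulf_eq0 -cE.
move: pN qN; rewrite !mpoly_unit_msize => pN qN.
have sp : (1 < msize p)%N.
  by move: p0 pN; rewrite -msize_poly_eq0; case: mmeasure => [|[]].
have sq : (1 < msize q)%N.
  by move: q0 qN; rewrite -msize_poly_eq0; case: mmeasure => [|[]].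
have sc : msize c = (msize p + msize q).-1 by rewrite cE msizeM.
have [|u [s [uU sP pE]]] := IH p _ p0; first by lia.
have [|v [t [vU tP qE]]] := IH q _ q0; first by lia.
exists (u * v), (s ++ t); split; first by rewrite unitrM uU.
  by move=> x; rewrite mem_cat => /orP[/sP|/tP].
by rewrite cE pE qE big_cat /= mulrACA.
Qed.

Lemma to_poly_unit (n : nat) (i : 'I_n.+1) (p : {mpoly K[n.+1]}) :
  (to_poly i p \is a GRing.unit) = (p \is a GRing.unit).
Proof.
apply/idP/idP => /unitrP[q [qp pq]]; apply/unitrP.
  exists (of_poly i q); rewrite -[p](to_polyK i) -!of_polyM.
  by rewrite qp pq of_poly1.
exists (to_poly i q).
have := congr1 (to_poly i) qp; have := congr1 (to_poly i) pq.
by rewrite !to_polyM to_poly1 => pq' qp'; split; [exact: qp'|exact: pq'].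
Qed.

Lemma irreducible_to_poly (n : nat) (i : 'I_n.+1) (d : {mpoly K[n.+1]}) :
  irreducible_elt d -> irreducible_elt (to_poly i d).
Proof.
case=> d0 dN dP; split.
- by rewrite to_poly_eq0.
- by rewrite to_poly_unit.
- move=> p q dE; have := dP (of_poly i p) (of_poly i q).
  rewrite -of_polyM -dE to_polyK => /(_ erefl).
  by rewrite -!(to_poly_unit i) !of_polyK.
Qed.

Lemma divides_to_poly (n : nat) (i : 'I_n.+1) (d p : {mpoly K[n.+1]}) :
  divides (to_poly i d) (to_poly i p) <-> divides d p.
Proof.
split=> -[q]; last by move=> ->; exists (to_poly i q); exact: to_polyM.
move=> pE; exists (of_poly i q).
by rewrite -[RHS](to_polyK i) to_polyM of_polyK -pE to_polyK.
Qed.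


(** Induction on the number of variables. In a variable that occurs in it, [d] is an irreducible
    univariate polynomial over a ring that is factorial by induction, so the univariate case
    applies. *)
Lemma mpoly_irreducible_prime (n : nat) (d : {mpoly K[n]}) :
  irreducible_elt d -> prime_elt d.
Proof.
elim: n d => [|n IH] d d_irr.
  (* Without variables every nonzero polynomial is a unit. *)
  have [d0 dN _] := d_irr; case/negP: dN.
  rewrite mpoly_unit_msize eqn_leq lt0n msize_poly_eq0 d0 andbT.
  apply/bigmax_leqP_seq => m _ _.
  by rewrite ltnS (_ : _ m = mdeg m) // mdegE big_ord0.
have [d0 dN _] := d_irr.
(* If no variable occurred, [d] would be a nonzero constant, hence a unit. *)
have [i di] : exists i, (0 < degv i d)%N.
  apply: NNPP => H; case/negP: dN.
  rewrite mpoly_unit_msize eqn_leq lt0n msize_poly_eq0 d0 andbT.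
  apply/bigmax_leqP_seq => m md _; rewrite ltnS (_ : _ m = mdeg m) // mdegE.
  rewrite leqn0 sum_nat_eq0; apply/forallP => i /=; rewrite -leqn0.
  apply/(degv_leP i d 0): md.
  by rewrite leqNgt; apply/negP => ?; apply: H; exists i.
split=> // a b dab.
have [_ _ P] : prime_elt (to_poly i d).
  apply: (irreducible_poly_prime (mpoly_factorial_step IH)).
    exact: irreducible_to_poly.
  by move: di; rewrite degv_size; case: size => [|[]].
move/(divides_to_poly i): dab; rewrite to_polyM => /P.
by case=> /divides_to_poly; [left | right].
Qed.

Lemma mpoly_factorial (n : nat) : factorial_ring {mpoly K[n]}.
Proof. by apply: mpoly_factorial_step => d; apply: mpoly_irreducible_prime. Qed.

Section Division.
Variables (n : nat) (i : 'I_n.+1).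
Implicit Types p q d : {mpoly K[n.+1]}.

Lemma degvM p q : p != 0 -> q != 0 -> degv i (p * q) = (degv i p + degv i q)%N.
Proof.
move=> p0 q0; rewrite !degv_size to_polyM.
by apply: size_mul_pred; rewrite to_poly_eq0.
Qed.

Lemma divides_degv d p : p != 0 -> divides d p -> (degv i d <= degv i p)%N.
Proof.
move=> p0 [q pE]; have : d * q != 0 by rewrite -pE.
by rewrite mulf_eq0 negb_or pE => /andP[d0 q0]; rewrite degvM // leq_addr.
Qed.

Lemma mpoly_bezout d p : irreducible_elt d -> (0 < degv i d)%N ->
  ~ divides d p ->
  exists u v c, [/\ c != 0, degv i c = 0%N & c = u * d + v * p].
Proof.
move=> d_irr di ndp.
have sd : (1 < size (to_poly i d))%N.
  by move: di; rewrite degv_size; case: size => [|[]].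
have [u [v [c [c0 cE]]]] : exists (u v : {poly {mpoly K[n]}}) (c : {mpoly K[n]}),
    c != 0 /\ c%:P = u * to_poly i d + v * to_poly i p.
  apply: (irreducible_poly_bezout (@mpoly_factorial n)
    (irreducible_to_poly i d_irr) sd).
  by move/divides_to_poly.
exists (of_poly i u), (of_poly i v), (of_poly i c%:P); split.
- by apply: contraNneq c0 => E; rewrite -polyC_eq0 -[c%:P](of_polyK i) E to_poly0.
- by rewrite of_polyC degv_mlift.
- by rewrite cE of_polyD !of_polyM !to_polyK.
Qed.

Lemma mpoly_pseudo_division d p : (0 < degv i d)%N ->
  exists l q r, [/\ l != 0, degv i l = 0%N, (degv i r < degv i d)%N
    & l * p = q * d + r].
Proof.
move=> di; set d' := to_poly i d; set p' := to_poly i p.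
have sd : (1 < size d')%N by move: di; rewrite degv_size -/d'; case: size => [|[]].
have d0 : d' != 0 by rewrite -size_poly_gt0; apply: leq_trans sd.
(* The scaling factor of pseudo-division is a power of the leading coefficient of [d'], so it is
   free of the chosen variable. *)
exists (of_poly i (lead_coef d' ^+ scalp p' d')%:P).
exists (of_poly i (p' %/ d')), (of_poly i (p' %% d')); split.
- rewrite of_polyC; apply/negP => /eqP/(congr1 (to_poly i)).
  rewrite to_poly_mlift to_poly0 => /eqP.
  by rewrite polyC_eq0 expf_eq0 lead_coef_eq0 (negPf d0) andbF.
- by rewrite of_polyC degv_mlift.
- apply: leq_ltn_trans (degv_of_poly _ _) _; rewrite degv_size -/d'.
  have : (size (p' %% d')%R < size d')%N by rewrite Pdiv.Idomain.ltn_modp.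
  by case: size => [|k]; case: size sd => [|[]].
- rewrite -{1}[p](to_polyK i) -/p' -{1}[d](to_polyK i) -/d' -!of_polyM -of_polyD.
  by rewrite mul_polyC Pdiv.Idomain.divp_eq.
Qed.

End Division.
End Factorial.

(** * Shifts of rational functions *)

Lemma frac_numden (R : idomainType) (x : {fraction R}) :
  x = tofrac (repr x).1 / tofrac (repr x).2.
Proof.
have d0 : (repr x).2 != 0 by apply: denom_ratioP.
suff xd : x * tofrac (repr x).2 = tofrac (repr x).1.
  by rewrite -xd mulfK // tofrac_eq0.
rewrite -{1}[x]reprK; unlock tofrac; rewrite -[LHS]FracField.pi_mul.
apply/eqmodP; rewrite /= FracField.equivfE /FracField.mulf /=.
by rewrite !numden_Ratio ?oner_eq0 ?mulr1 // mulrC.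
Qed.

Lemma fracW (R : idomainType) (x : {fraction R}) :
  exists p q : R, q != 0 /\ x = tofrac p / tofrac q.
Proof.
exists (repr x).1, (repr x).2; split; last exact: frac_numden.
exact: denom_ratioP.
Qed.

Lemma fracW2 (R : idomainType) (x y : {fraction R}) :
  exists p q r : R,
    [/\ r != 0, x = tofrac p / tofrac r & y = tofrac q / tofrac r].
Proof.
have [p [r [r0 ->]]] := fracW x; have [q [s [s0 ->]]] := fracW y.
exists (p * s), (q * r), (r * s); split; first exact: mulf_neq0.
  by rewrite !tofracM -mulf_div divff ?tofrac_eq0 // mulr1.
by rewrite [r * s]mulrC !tofracM -mulf_div divff ?tofrac_eq0 // mulr1.
Qed.

Section Shift.
Variables (K : fieldType) (m n : nat).
Local Notation P := {mpoly K[m.+1]}.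
Local Notation F := {fraction P}.
Local Notation V := 'rV[int]_(n.+1).
Implicit Types (k l : V) (p q : P) (x y : F).

HB.instance Definition _ k := GRing.RMorphism.copy (@shiftP K m n k)
  (comp_mpoly [tuple ('X_i + ((shift_exp k i)%:~R)%:MP) | i < m.+1]).

Lemma shift_expD k l (i : 'I_m.+1) : shift_exp (k + l) i = shift_exp k i + shift_exp l i.
Proof. by rewrite /shift_exp; case: ifP => _; rewrite ?mxE ?addr0. Qed.

Lemma shift_exp0 i : shift_exp (0 : V) (i : 'I_m.+1) = 0.
Proof. by rewrite /shift_exp; case: ifP => _; rewrite ?mxE. Qed.

Lemma shiftPC k c : shiftP k (c%:MP : P) = c%:MP.
Proof. exact: comp_mpolyC. Qed.

Lemma shiftPX k i :
  shiftP k ('X_i : P) = 'X_i + ((shift_exp k i)%:~R)%:MP.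
Proof. by rewrite /shiftP comp_mpolyXU -tnth_nth tnth_mktuple. Qed.

Lemma shiftP0 p : shiftP (0 : V) p = p.
Proof.
apply: (@mpoly_rmorph_eq _ _ _ (@shiftP K m n 0) idfun) => [c|i] /=.
  exact: shiftPC.
by rewrite shiftPX shift_exp0 mulr0z mpolyC0 addr0.
Qed.

Lemma shiftPD k l p : shiftP (k + l) p = shiftP k (shiftP l p).
Proof.
apply: (@mpoly_rmorph_eq _ _ _ (@shiftP K m n (k + l))
  (@shiftP K m n k \o @shiftP K m n l)) => [c|i] /=; first by rewrite !shiftPC.
rewrite !shiftPX (rmorphD (@shiftP K m n k)) /= shiftPX shiftPC shift_expD.
by rewrite intrD mpolyCD addrA.
Qed.

Lemma shiftPK k : cancel (@shiftP K m n k) (shiftP (- k)).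
Proof. by move=> p; rewrite -shiftPD addNr shiftP0. Qed.

Lemma shiftP_eq0 k p : (shiftP k p == 0) = (p == 0).
Proof.
apply/eqP/eqP => [E|->]; last exact: (rmorph0 (@shiftP K m n k)).
by rewrite -[p](shiftPK k) E; apply: (rmorph0 (@shiftP K m n (- k))).
Qed.

Lemma shiftP_divides k d p : divides d p -> divides (shiftP k d) (shiftP k p).
Proof.
by case=> q ->; exists (shiftP k q); apply: (rmorphM (@shiftP K m n k)).
Qed.

(** The substitution gives ['X_i] an image of degree at most 1 in variable [i], and the other
    variables images free of it. *)
Lemma degv_shiftP_le i k p : (degv i (shiftP k p) <= degv i p)%N.
Proof.
rewrite /shiftP comp_mpolyEX big_seq; apply: degv_sum => e pe.
rewrite -mul_mpolyC; apply: leq_trans (degvM_le _ _ _) _; rewrite degvC add0n.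
rewrite comp_mpolyX; apply: leq_trans (degv_prod_le _ _ _) _.
rewrite (bigD1 i) //= big1 ?addn0 => [|j ji].
  apply: leq_trans (degv_exp_le _ _ _) _; rewrite tnth_mktuple.
  have le1 : (degv i ('X_i + ((shift_exp k i)%:~R)%:MP : P)%R <= 1)%N.
    by apply: degvD; rewrite ?degvC //; apply: leq_trans (degvX _ _ _) _; rewrite eqxx.
  apply: leq_trans (_ : 1 * e i <= _)%N; first by rewrite leq_mul2r le1 orbT.
  by rewrite mul1n; apply/degv_leP: pe.
apply/eqP; rewrite -leqn0; apply: leq_trans (degv_exp_le _ _ _) _.
rewrite tnth_mktuple -[X in (_ <= X)%N](mul0n (e j)) leq_mul2r; apply/orP; right.
by apply: degvD; rewrite ?degvC //; apply: leq_trans (degvX _ _ _) _; rewrite (negPf ji).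
Qed.

Lemma degv_shiftP i k p : degv i (shiftP k p) = degv i p.
Proof.
apply/eqP; rewrite eqn_leq degv_shiftP_le -{1}[p](shiftPK k).
exact: degv_shiftP_le.
Qed.

(** [shiftF] is defined through the representative picked by [repr]. The choice is immaterial: two
    representatives satisfy a cross-multiplied polynomial identity, which [shiftP] preserves. *)
Lemma shiftF_frac k p q : q != 0 ->
  shiftF k (tofrac p / tofrac q) = tofrac (shiftP k p) / tofrac (shiftP k q).
Proof.
move=> q0; rewrite /shiftF; set x := tofrac p / tofrac q.
have d0 : (repr x).2 != 0 by apply: denom_ratioP.
have : p * (repr x).2 = (repr x).1 * q.
  apply/eqP; rewrite -tofrac_eq !rmorphM /= -eqr_div ?tofrac_eq0 //.
  by apply/eqP; exact: (frac_numden x).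
move/(congr1 (shiftP k)); rewrite !(rmorphM (@shiftP K m n k)) => E.
apply/eqP; rewrite eqr_div ?tofrac_eq0 ?shiftP_eq0 // -!tofracM tofrac_eq E.
by rewrite eqxx.
Qed.

Lemma shiftF_tofrac k p : shiftF k (tofrac p) = tofrac (shiftP k p).
Proof.
have := shiftF_frac k p (oner_neq0 _).
by rewrite (rmorph1 (@shiftP K m n k)) tofrac1 !divr1.
Qed.

Lemma shiftF_zmod_morphism k : zmod_morphism (@shiftF K m n k).
Proof.
move=> x y; have [p [q [r [r0 -> ->]]]] := fracW2 x y.
rewrite -mulrBl -tofracB !shiftF_frac // -mulrBl -tofracB.
by congr (tofrac _ / _); apply: (rmorphB (@shiftP K m n k)).
Qed.

Lemma shiftF_monoid_morphism k : monoid_morphism (@shiftF K m n k).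
Proof.
split=> [|x y].
  by rewrite -tofrac1 shiftF_tofrac (rmorph1 (@shiftP K m n k)).
have [p [q [q0 ->]]] := fracW x; have [p' [q' [q'0 ->]]] := fracW y.
rewrite mulf_div -!tofracM !shiftF_frac ?mulf_neq0 // mulf_div -!tofracM.
by congr (tofrac _ / tofrac _); apply: (rmorphM (@shiftP K m n k)).
Qed.

HB.instance Definition _ k :=
  GRing.isZmodMorphism.Build F F (@shiftF K m n k) (shiftF_zmod_morphism k).
HB.instance Definition _ k :=
  GRing.isMonoidMorphism.Build F F (@shiftF K m n k) (shiftF_monoid_morphism k).

Lemma shiftF0 x : shiftF (0 : V) x = x.
Proof. by have [p [q [q0 ->]]] := fracW x; rewrite shiftF_frac // !shiftP0. Qed.

Lemma shiftFD k l x : shiftF (k + l) x = shiftF k (shiftF l x).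
Proof.
have [p [q [q0 ->]]] := fracW x.
transitivity (shiftF k (tofrac (shiftP l p) / tofrac (shiftP l q))).
  by rewrite !shiftF_frac ?shiftP_eq0 // !shiftPD.
by congr shiftF; rewrite shiftF_frac.
Qed.

Lemma shiftFC k l x : shiftF k (shiftF l x) = shiftF l (shiftF k x).
Proof. by rewrite -!shiftFD addrC. Qed.

End Shift.

(** * Shifts and the homogeneous part of top degree *)

Section ShiftDegree.
Variables (K : fieldType) (m n : nat).
Local Notation P := {mpoly K[m.+1]}.
Local Notation V := 'rV[int]_(n.+1).
Implicit Types (a b p : P) (k : V).

Lemma msizeM_leq (p q : P) : (msize (p * q)%R <= (msize p + msize q).-1)%N.
Proof.
have [->|p0] := eqVneq p 0; first by rewrite mul0r msize0.
have [->|q0] := eqVneq q 0; first by rewrite mulr0 msize0.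
by rewrite msizeM.
Qed.

(* Shifting does not change the homogeneous part of top degree; this is why a
   shift of d that is associate to d equals d. *)
Definition same_top N a b :=
  [/\ (msize a <= N.+1)%N, (msize b <= N.+1)%N & (msize (a - b)%R <= N)%N].

Lemma same_topM N M a b a' b' :
  same_top N a b -> same_top M a' b' -> same_top (N + M) (a * a') (b * b').
Proof.
move=> [aN bN abN] [a'M b'M abM]; split.
- by apply: leq_trans (msizeM_leq _ _) _; lia.
- by apply: leq_trans (msizeM_leq _ _) _; lia.
have -> : a * a' - b * b' = (a - b) * a' + b * (a' - b').
  by rewrite mulrBl mulrBr addrA subrK.
apply: leq_trans (msizeD_le _ _) _; rewrite geq_max; apply/andP; split.
  by apply: leq_trans (msizeM_leq _ _) _; lia.
by apply: leq_trans (msizeM_leq _ _) _; lia.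
Qed.

Lemma same_top1 : same_top 0 1 1.
Proof. by split; rewrite ?msize1 // subrr msize0. Qed.

Lemma same_topX N a b e : same_top N a b -> same_top (N * e) (a ^+ e) (b ^+ e).
Proof.
move=> ab; elim: e => [|e IH]; first by rewrite muln0 !expr0; apply: same_top1.
by rewrite !exprS mulnS; apply: same_topM.
Qed.

Lemma same_top_prod I (r : seq I) (e : I -> nat) (F G : I -> P) :
  (forall i, same_top (e i) (F i) (G i)) ->
  same_top (\sum_(i <- r) e i) (\prod_(i <- r) F i) (\prod_(i <- r) G i).
Proof.
move=> FG; elim: r => [|i r IH]; first by rewrite !big_nil; apply: same_top1.
by rewrite !big_cons; apply: same_topM.
Qed.

(** Monomial by monomial: a variable and its shift agree in top degree, and [same_top] is
    multiplicative. *)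
Lemma msize_shift_sub k p : p != 0 -> (msize (shiftP k p - p)%R < msize p)%N.
Proof.
move=> p0; have [N pN] : exists N, msize p = N.+1.
  by exists (msize p).-1; rewrite prednK // lt0n msize_poly_eq0.
rewrite pN ltnS {1}/shiftP comp_mpolyEX [X in (_ - X)%R]mpolyE -sumrB big_seq.
apply: (big_ind (fun q : P => msize q <= N)%N) => [|q r qN rN|e pe].
- by rewrite msize0.
- by apply: leq_trans (msizeD_le _ _) _; rewrite geq_max qN.
rewrite -scalerBr; apply: leq_trans (msizeZ_le _ _) _.
have le_eN : (mdeg e <= N)%N by rewrite -ltnS -pN; apply: msize_mdeg_lt.
apply: leq_trans le_eN; rewrite comp_mpolyX mpolyXE_id mdegE.
apply: (fun H => let: And3 _ _ x := H in x).
rewrite (eq_bigr (fun i => 1 * e i)%N) => [|i _]; last by rewrite mul1n.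
apply: same_top_prod => i; apply: same_topX; rewrite tnth_mktuple.
have cN (c : K) : (msize (c%:MP : P) <= 1)%N by rewrite msizeC leq_b1.
have XN : msize ('X_i : P) = 2%N by rewrite msizeX mdeg1.
split; rewrite ?XN // ?addrK; last by rewrite addrAC subrr add0r.
by apply: leq_trans (msizeD_le _ _) _; rewrite geq_max XN (leq_trans (cN _)).
Qed.

(** If the cofactor [q] were not 1, the difference [d * (q - 1)] would have at least the degree of
    [d], whereas a shift only alters terms of lower degree. *)
Lemma shiftP_associate k d : d != 0 -> divides d (shiftP k d : P) ->
  shiftP k d = d.
Proof.
move=> d0 [q dq]; apply/eqP; rewrite -subr_eq0; apply/negPn/negP => ne0.
have := msize_shift_sub k d0; move: ne0.
have -> : shiftP k d - d = d * (q - 1) by rewrite dq mulrBr mulr1.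
rewrite mulf_eq0 negb_or => /andP[_ q0]; rewrite msizeM //.
have : (0 < msize (q - 1)%R)%N by rewrite lt0n msize_poly_eq0.
by case: (msize (q - 1)%R) => // e _; rewrite addnS ltnNge leq_addr.
Qed.

End ShiftDegree.

(** * Expansions in powers of an irreducible polynomial *)

Section Digit.
Variables (F : fieldType) (d : F) (W O : F -> Prop) (j : nat).
Hypotheses (d0 : d != 0) (j_gt0 : (0 < j)%N).
Hypotheses (W0 : W 0) (WB : forall x y, W x -> W y -> W (x - y)).
Hypotheses (OB : forall x y, O x -> O y -> O (x - y)).
Hypotheses (WO : forall x, W x -> O x) (OMd : forall x, O x -> O (x * d)).
Hypothesis W_dO : forall x, W x -> O (x / d) -> x = 0.
Hypothesis O_split : forall x, O x -> exists2 w, W w & O ((x - w) / d).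
Hypothesis O_exhaust : forall x, exists N, O (x * d ^+ N).

(* low_part N x: x lies in d O + d^-1 W + d^-2 W + ... + d^-N W. *)
Fixpoint low_part (N : nat) (x : F) : Prop :=
  if N is M.+1 then exists2 w, W w & low_part M (x - w / d ^+ N) else O (x / d).

Lemma low_partS N x : low_part N x -> low_part N.+1 x.
Proof. by move=> xN; exists 0; rewrite // mul0r subr0. Qed.

Lemma low_part_leq N M x : (N <= M)%N -> low_part N x -> low_part M x.
Proof.
move=> /subnK <-; elim: (M - N)%N => // e IH xN.
by rewrite addSn; apply/low_partS/IH.
Qed.

Lemma low_partB N x y : low_part N x -> low_part N y -> low_part N (x - y).
Proof.
elim: N x y => [|N IH] x y /=; first by move=> xO yO; rewrite mulrBl; apply: OB.
move=> [w wW xN] [v vW yN]; exists (w - v); first exact: WB.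
have -> : x - y - (w - v) / d ^+ N.+1 =
    x - w / d ^+ N.+1 - (y - v / d ^+ N.+1) by ring.
exact: IH.
Qed.

Lemma low_part0 N : low_part N 0.
Proof.
elim: N => [|N IH] /=; last exact: low_partS.
by rewrite mul0r; apply: WO.
Qed.

Lemma low_part_pole N x : low_part N x -> O (x * d ^+ N).
Proof.
elim: N x => [|N IH] x /=; first by move=> /OMd; rewrite divfK ?mulr1.
move=> [w wW /IH xN].
have -> : x * d ^+ N.+1 = (x - w / d ^+ N.+1) * d ^+ N * d - (0 - w).
  by rewrite sub0r opprK -mulrA -exprSr mulrBl divfK ?expf_neq0 // subrK.
by apply: OB; [apply: OMd | apply/WO/WB].
Qed.

(** This is the uniqueness of digits. Multiplying by a power of [d] makes everything but the most
    polar digit [w] regular; hence [O (w / d)], so [w = 0], and induction removes the other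
    digits. *)
Lemma low_part_eq0 N x : W x -> low_part N x -> x = 0.
Proof.
move=> xW; elim: N => [|N IH] /=; first exact: W_dO.
move=> [w wW xN]; apply: IH.
suff w0 : w = 0 by move: xN; rewrite w0 mul0r subr0.
apply: W_dO => //.
have -> : w / d = x * d ^+ N - (x - w / d ^+ N.+1) * d ^+ N.
  have dN0 : d ^+ N != 0 by rewrite expf_neq0.
  by rewrite exprSr; field; rewrite d0.
have Od : forall e y, O y -> O (y * d ^+ e).
  by elim=> [|e IHe] y yO; rewrite ?mulr1 // exprSr mulrA; apply/OMd/IHe.
by apply: OB; [apply/Od/WO | apply: low_part_pole].
Qed.

(** Existence of the expansion, by induction on the pole order: the digit of the highest pole is
    peeled off with [O_split]. *)
Lemma low_part_split x : exists2 w, W w & exists N, low_part N (x - w).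
Proof.
have [N] := O_exhaust x; elim: N x => [|N IH] x.
  by rewrite mulr1 => /O_split[w wW xO]; exists w => //; exists 0.
move=> /O_split[v vW xO].
have [|w wW [M xM]] := IH (x - v / d ^+ N.+1).
  suff -> : (x - v / d ^+ N.+1) * d ^+ N = (x * d ^+ N.+1 - v) / d by [].
  have dN0 : d ^+ N != 0 by rewrite expf_neq0.
  by rewrite exprSr; field; rewrite d0.
(* The peeled term has a negative exponent of [d], so putting it back leaves the constant digit [w]
   unchanged. *)
exists w => //; exists (maxn M N.+1).
have vN : low_part (maxn M N.+1) (0 - v / d ^+ N.+1).
  apply: (@low_part_leq N.+1); first exact: leq_maxr.
  apply: low_partB; first exact: low_part0.
  by exists v => //; rewrite subrr; apply: low_part0.
have -> : x - w = x - v / d ^+ N.+1 - w - (0 - v / d ^+ N.+1) by ring.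
by apply: low_partB vN; apply: low_part_leq xM; apply: leq_maxl.
Qed.

(** Multiplication by [d ^+ j] moves the wanted coefficient to exponent 0, the one that [low_part]
    skips. *)
Definition is_digit (x w : F) : Prop :=
  W w /\ exists N, low_part N (x * d ^+ j - w).

(* The coefficient of d^-j in the d-adic expansion of x with digits in W. *)
Definition digit (x : F) : F := epsilon (inhabits 0) (is_digit x).

Lemma digitP x : is_digit x (digit x).
Proof.
apply: epsilon_spec.
by have [w wW [N xN]] := low_part_split (x * d ^+ j); exists w; split=> //; exists N.
Qed.

Lemma digit_eq x w : is_digit x w -> digit x = w.
Proof.
have [vW [N vN]] := digitP x; case=> wW [M wM].
apply/eqP; rewrite -subr_eq0; apply/eqP.
apply: (@low_part_eq0 (maxn N M)); first exact: WB.
have -> : digit x - w = x * d ^+ j - w - (x * d ^+ j - digit x) by ring.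
by apply: low_partB; apply: low_part_leq; [apply: leq_maxr | eassumption
  | apply: leq_maxl | eassumption].
Qed.

Lemma digitB x y : digit (x - y) = digit x - digit y.
Proof.
have [wW [N xN]] := digitP x; have [vW [M yM]] := digitP y.
apply: digit_eq; split; first exact: WB.
exists (maxn N M).
have -> : (x - y) * d ^+ j - (digit x - digit y) =
    x * d ^+ j - digit x - (y * d ^+ j - digit y) by ring.
by apply: low_partB; [apply: low_part_leq xN; apply: leq_maxl
  | apply: low_part_leq yM; apply: leq_maxr].
Qed.

Lemma digit_integral x : O x -> digit x = 0.
Proof.
move=> xO; apply: digit_eq; split=> //; exists 0%N; rewrite /= subr0.
rewrite -(prednK j_gt0) exprSr mulrA mulfK //.
by elim: j.-1 => [|e IH]; rewrite ?mulr1 // exprSr mulrA; apply: OMd.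
Qed.

Lemma digit_pole w : W w -> digit (w / d ^+ j) = w.
Proof.
move=> wW; apply: digit_eq; split=> //; exists 0%N.
by rewrite divfK ?expf_neq0 // subrr; apply: low_part0.
Qed.

(** Applying [s] to every digit of an expansion gives an expansion of the image, and digits are
    unique. *)
Lemma digit_equivariant (s : {rmorphism F -> F}) x :
  s d = d -> (forall y, W y -> W (s y)) -> (forall y, O y -> O (s y)) ->
  digit (s x) = s (digit x).
Proof.
move=> sd sW sO; have [wW [N xN]] := digitP x.
apply: digit_eq; split; first exact: sW.
exists N; rewrite -sd -rmorphXn -rmorphM -rmorphB.
elim: N (_ - _) xN => [|N IH] y /=.
  by rewrite -{2}sd -fmorph_div; apply: sO.
move=> [v vW yN]; exists (s v); first exact: sW.
by rewrite -sd -rmorphXn -fmorph_div -rmorphB; apply: IH.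
Qed.

End Digit.

(** * Sums over an orbit *)

Section OrbitSum.
Variables (V : zmodType) (F : zmodType) (s : V -> F -> F) (G : V -> Prop).
Variables (d : F) (D : F -> F) (U : F -> Prop).
Hypotheses (s0 : forall x, s 0 x = x)
  (sD : forall k l x, s (k + l) x = s k (s l x))
  (sB : forall k x y, s k (x - y) = s k x - s k y).
Hypotheses (G0 : G 0) (GB : forall k l, G k -> G l -> G (k - l)).
Hypotheses (U0 : U 0) (UB : forall x y, U x -> U y -> U (x - y)).
Hypothesis DB : forall x y, D (x - y) = D x - D y.
Hypothesis D_equivariant : forall k x, G k -> s k d = d -> D (s k x) = s k (D x).
Hypothesis U_coinvariant : forall k x, G k -> s k d = d -> U (s k (D x) - D x).

(** The sign is negative because [D (s k x)] is meant to read the pole of [x] along [s (- k) d];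
    this point labels a coset modulo the stabiliser of [d]. *)
Definition in_orbit (p : F) : Prop := exists2 k, G k & s (- k) d = p.

(** The list may exceed the support of the summands, so that several elements can share one list. *)
Definition covers (l : seq F) (x : F) : Prop :=
  [/\ uniq l, forall p, p \in l -> in_orbit p
    & forall k, G k -> D (s k x) <> 0 -> s (- k) d \in l].

Hypothesis coverable : forall x, exists l, covers l x.

Definition orbit_rep (p : F) : V :=
  epsilon (inhabits 0) (fun k => G k /\ s (- k) d = p).

Lemma orbit_repP p : in_orbit p -> G (orbit_rep p) /\ s (- orbit_rep p) d = p.
Proof.
case=> k kG kp; apply: (epsilon_spec (inhabits 0)
  (fun k => G k /\ s (- k) d = p)).
by exists k.
Qed.

Definition orbit_cover (x : F) : seq F :=
  epsilon (inhabits [::]) (fun l => covers l x).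

Lemma orbit_coverP x : covers (orbit_cover x) x.
Proof.
exact: (epsilon_spec (inhabits [::]) (fun l => covers l x) (coverable x)).
Qed.

Definition sum_over (l : seq F) (x : F) : F :=
  \sum_(p <- l) D (s (orbit_rep p) x).

(* Modulo U each summand depends only on the coset of the representative, so
   this is the sum of D (k x) over k in G modulo the stabiliser of d. *)
Definition orbit_sum (x : F) : F := sum_over (orbit_cover x) x.

Let GN k : G k -> G (- k).
Proof. by rewrite -sub0r; apply: GB. Qed.

Let GD k l : G k -> G l -> G (k + l).
Proof. by move=> kG lG; rewrite -[l]opprK; apply/GB/GN. Qed.

Let UD x y : U x -> U y -> U (x + y).
Proof. by move=> xU yU; rewrite -[y]opprK -[- y]sub0r; apply/UB/UB. Qed.

Let sK k x : s k (s (- k) x) = x.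
Proof. by rewrite -sD subrr s0. Qed.

(** Both lists contain every orbit point with a nonzero summand, so they are permutations of each
    other once the zero summands are filtered out. *)
Lemma sum_over_covers l l' x : covers l x -> covers l' x ->
  sum_over l x = sum_over l' x.
Proof.
move=> [l_uniq l_orb lx] [l'_uniq l'_orb l'x]; rewrite /sum_over.
pose nz p := D (s (orbit_rep p) x) != 0.
have restrict r : \sum_(p <- r) D (s (orbit_rep p) x) =
    \sum_(p <- [seq p <- r | nz p]) D (s (orbit_rep p) x).
  rewrite big_filter [LHS](bigID nz) /= [X in _ + X]big1 ?addr0 // => p.
  by move=> /negPn/eqP.
rewrite (restrict l) (restrict l'); apply/perm_big/uniq_perm; rewrite ?filter_uniq // => p.
rewrite !mem_filter; have [/= /eqP pN|//] := boolP (nz p).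
apply/idP/idP => [/l_orb|/l'_orb] /orbit_repP[pG pE].
  by rewrite -pE; apply: l'x.
by rewrite -pE; apply: lx.
Qed.

Lemma orbit_sumE l x : covers l x -> orbit_sum x = sum_over l x.
Proof. exact/sum_over_covers/orbit_coverP. Qed.

Lemma orbit_sumB x y : orbit_sum (x - y) = orbit_sum x - orbit_sum y.
Proof.
(* One list covering [x], [y] and [x - y] allows a comparison term by term. *)
pose l := undup (orbit_cover x ++ orbit_cover y ++ orbit_cover (x - y)).
have l_orb p : p \in l -> in_orbit p.
  have cov z := let: And3 _ H _ := orbit_coverP z in H p.
  by rewrite mem_undup !mem_cat => /or3P[] /cov.
have l_cov z : {subset orbit_cover z <= l} -> covers l z.
  move=> sub; split=> //; first exact: undup_uniq.
  by have [_ _ H] := orbit_coverP z; move=> k kG kz; apply/sub/H.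
rewrite !(@orbit_sumE l) ?/sum_over -?sumrB.
- by apply: eq_bigr => p _; rewrite sB DB.
- by apply: l_cov => p py; rewrite mem_undup !mem_cat py orbT.
- by apply: l_cov => p px; rewrite mem_undup !mem_cat px.
- by apply: l_cov => p pxy; rewrite mem_undup !mem_cat pxy !orbT.
Qed.

(** The translate by [- k] of a cover of [s k x] covers [x]. Matching summands use two
    representatives of one coset; these differ by an element fixing [d], and [U_coinvariant] absorbs
    the change. *)
Lemma orbit_sum_invariant k x : G k -> U (orbit_sum (s k x) - orbit_sum x).
Proof.
move=> kG; set l := orbit_cover (s k x).
have [l_uniq l_orb lx] := orbit_coverP (s k x).
have repD p : in_orbit p ->
    G (orbit_rep p + k) /\ s (- (orbit_rep p + k)) d = s (- k) p.
  move=> /orbit_repP[pG pE]; split; first exact: GD.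
  by rewrite opprD addrC sD pE.
have cov : covers (map (s (- k)) l) x.
  split.
  - by rewrite map_inj_uniq // => p q /(congr1 (s k)); rewrite !sK.
  - by move=> _ /mapP[p /l_orb/repD[pG pE] ->]; exists (orbit_rep p + k).
  move=> h hG hx; apply/mapP; exists (s (- (h - k)) d).
    by apply: lx; [apply: GB | rewrite -sD subrK].
  by rewrite -sD opprB addrA addNr add0r.
rewrite (orbit_sumE cov) /sum_over big_map -/l /orbit_sum /sum_over -sumrB big_seq.
apply: big_ind => [|x1 x2|p pl]; [exact: U0 | exact: UD |].
have [qG qE] := repD _ (l_orb _ pl).
have [rG rE] := orbit_repP (ex_intro2 _ _ _ qG qE).
set q := orbit_rep p + k in qG qE *; set r := orbit_rep _ in rG rE *.
have qrG : G (q - r) by apply: GB.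
have qr : s (q - r) d = d by rewrite sD rE -qE sK.
by rewrite -sD -/q -{1}(subrK r q) sD D_equivariant //; apply: U_coinvariant.
Qed.

(** Here [[:: d]] covers [x]. The representative chosen for [d] is some stabiliser element, perhaps
    not 0, so the equality holds only modulo [U]. *)
Lemma orbit_sum_local x :
  (forall k, G k -> s k d <> d -> D (s k x) = 0) -> U (orbit_sum x - D x).
Proof.
move=> xD; have sNd k : s k d = d -> s (- k) d = d.
  by move=> {1}<-; rewrite -sD addNr s0.
have d_orb : in_orbit d by exists 0; rewrite // oppr0 s0.
rewrite (@orbit_sumE [:: d]).
  rewrite /sum_over big_seq1; have [dG /sNd] := orbit_repP d_orb.
  by rewrite opprK => dE; rewrite D_equivariant //; apply: U_coinvariant.
split=> // [p|k kG kx]; first by rewrite inE => /eqP->.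
by rewrite inE; apply/eqP/sNd; apply: NNPP => kd; apply: kx; apply: xD.
Qed.

End OrbitSum.

(** * The local ring at d *)

Section Fractions.
Variable R : idomainType.
Implicit Types a b c e : R.

Lemma frac_eq a b c e : b != 0 -> e != 0 ->
  tofrac a / tofrac b = tofrac c / tofrac e <-> a * e = c * b.
Proof.
move=> b0 e0; split=> [/eqP|E].
  by rewrite eqr_div ?tofrac_eq0 // -!tofracM tofrac_eq => /eqP.
by apply/eqP; rewrite eqr_div ?tofrac_eq0 // -!tofracM E.
Qed.

Lemma fracB a b c e : b != 0 -> e != 0 ->
  tofrac a / tofrac b - tofrac c / tofrac e =
    tofrac (a * e - c * b) / tofrac (b * e).
Proof.
by move=> b0 e0; rewrite -mulNr addf_div ?tofrac_eq0 // mulNr tofracB !tofracM.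
Qed.

Lemma fracM a b c e :
  tofrac a / tofrac b * (tofrac c / tofrac e) = tofrac (a * c) / tofrac (b * e).
Proof. by rewrite mulf_div -!tofracM. Qed.

Lemma frac_div a b c : tofrac a / tofrac b / tofrac c = tofrac a / tofrac (b * c).
Proof. by rewrite -mulrA -invfM -tofracM mulrC. Qed.

End Fractions.

Section RationalFunctions.
Variables (K : fieldType) (m n : nat).
Local Notation P := {mpoly K[m.+1]}.
Local Notation F := {fraction P}.
Local Notation V := 'rV[int]_(n.+1).
Implicit Types (k : V) (p q : P) (x y c : F).

Lemma degv0 i : degv i (0 : P) = 0%N.
Proof. by rewrite /degv msupp0 big_nil. Qed.

Lemma degv1 i : degv i (1 : P) = 0%N.
Proof. exact: degvC. Qed.

Lemma degvB i p q N :
  (degv i p <= N)%N -> (degv i q <= N)%N -> (degv i (p - q) <= N)%N.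
Proof.
move=> pN qN; apply: degvD => //; rewrite -mulN1r.
by apply: leq_trans (degvM_le _ _ _) _; rewrite -mpolyC1 -mpolyCN degvC.
Qed.

Lemma polyx1_deg_lt0 N : (0 < N)%N -> polyx1_deg_lt N (0 : F).
Proof.
by move=> N0; exists 0, 1; rewrite oner_eq0 degv0 degv1 tofrac0 mul0r.
Qed.

Lemma polyx1_deg_ltB N x y :
  polyx1_deg_lt N x -> polyx1_deg_lt N y -> polyx1_deg_lt N (x - y).
Proof.
move=> [p [q [q0 qd pd ->]]] [p' [q' [q'0 q'd p'd ->]]].
exists (p * q' - p' * q), (q * q'); split.
- exact: mulf_neq0.
- by apply/eqP; rewrite -leqn0 (leq_trans (degvM_le _ _ _)) // qd q'd.
- rewrite -(ltn_predK pd) ltnS; apply: degvB; apply: leq_trans (degvM_le _ _ _) _.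
    by rewrite q'd addn0 -ltnS (ltn_predK pd).
  by rewrite qd addn0 -ltnS (ltn_predK pd).
- exact: fracB.
Qed.

Lemma polyx1_deg_lt_shift N k x :
  polyx1_deg_lt N x -> polyx1_deg_lt N (shiftF k x).
Proof.
move=> [p [q [q0 qd pd ->]]]; exists (shiftP k p), (shiftP k q).
by rewrite shiftP_eq0 !degv_shiftP shiftF_frac.
Qed.

Lemma inKt0 : inKt (0 : F).
Proof.
by exists 0, 1; rewrite oner_eq0 tofrac0 mul0r; split=> // i _; rewrite degv0 degv1.
Qed.

Lemma inKtB x y : inKt x -> inKt y -> inKt (x - y).
Proof.
move=> [p [q [q0 pq ->]]] [p' [q' [q'0 pq' ->]]].
exists (p * q' - p' * q), (q * q'); split; [exact: mulf_neq0| |exact: fracB].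
move=> i /[dup]/pq[pd qd]/pq'[p'd q'd].
have M0 (a b : P) : degv i a = 0%N -> degv i b = 0%N -> (degv i (a * b) <= 0)%N.
  by move=> a0 b0; rewrite (leq_trans (degvM_le _ _ _)) // a0 b0.
by split; apply/eqP; rewrite -leqn0; [apply: degvB|]; apply: M0.
Qed.

Lemma inKt_shift k x : inKt x -> inKt (shiftF k x).
Proof.
move=> [p [q [q0 pq ->]]]; exists (shiftP k p), (shiftP k q).
by rewrite shiftP_eq0 shiftF_frac //; split=> // i /pq; rewrite !degv_shiftP.
Qed.

Lemma polyx1_deg_lt_inKt N c x : (0 < m)%N ->
  inKt c -> polyx1_deg_lt N x -> polyx1_deg_lt N (c * x).
Proof.
move=> m0 [p [q [q0 pq ->]]] [p' [q' [q'0 q'd p'd ->]]].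
have [|pd qd] := pq (ix1 m); first by rewrite -val_eqE /= inordK.
exists (p * p'), (q * q'); split; [exact: mulf_neq0| | |exact: fracM].
  by apply/eqP; rewrite -leqn0 (leq_trans (degvM_le _ _ _)) // qd q'd.
by apply: leq_ltn_trans p'd; rewrite (leq_trans (degvM_le _ _ _)) // pd.
Qed.

Lemma shiftP_fixed k p : inG k ->
  (forall i : 'I_m.+1, i != ord0 -> degv i p = 0%N) -> shiftP k p = p.
Proof.
move=> k0 pd; rewrite [RHS]mpolyE /shiftP comp_mpolyEX.
apply: eq_big_seq => e pe; rewrite comp_mpolyX mpolyXE_id; congr (_ *: _).
apply: eq_bigr => i _; rewrite tnth_mktuple.
have [->|i0] := eqVneq i ord0.
  by rewrite /shift_exp /= (_ : inord 0 = 0) ?k0 ?mpolyC0 ?addr0 //; apply/val_inj; rewrite /= inordK.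
suff -> : e i = 0%N by rewrite !expr0.
by apply/eqP; rewrite -leqn0; apply/(degv_leP i p 0): pe; rewrite pd.
Qed.

Lemma inKt_fixed k c : inG k -> inKt c -> shiftF k c = c.
Proof.
move=> k0 [p [q [q0 pq ->]]]; rewrite shiftF_frac //.
by rewrite !shiftP_fixed // => i /pq[].
Qed.

End RationalFunctions.

Section LocalRing.
Variables (K : fieldType) (m n : nat) (d : {mpoly K[m.+1]}).
Local Notation P := {mpoly K[m.+1]}.
Local Notation F := {fraction P}.
Local Notation V := 'rV[int]_(n.+1).
Local Notation i1 := (ix1 m).
Hypotheses (d_irr : irreducible_elt d) (d_deg : (0 < degv i1 d)%N).
Implicit Types (k : V) (p q u v : P) (x y : F).

Let W : F -> Prop := polyx1_deg_lt (degv i1 d).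

(** The localization at the prime ideal generated by [d]. *)
Definition regular_at x : Prop :=
  exists u v, ~ divides d v /\ x = tofrac u / tofrac v.

Lemma irr_neq0 : d != 0.
Proof. by case: d_irr. Qed.

Lemma ndivides_neq0 v : ~ divides d v -> v != 0.
Proof. by move=> ndv; apply/eqP => v0; apply: ndv; rewrite v0; apply: divides0. Qed.

Lemma ndividesM u v : ~ divides d u -> ~ divides d v -> ~ divides d (u * v).
Proof. by have [_ _ dP] := mpoly_irreducible_prime d_irr; move=> du dv /dP[]. Qed.

Lemma ndivides_deg q : q != 0 -> (degv i1 q < degv i1 d)%N -> ~ divides d q.
Proof. by move=> q0 qd /(divides_degv i1 q0); rewrite leqNgt qd. Qed.

Lemma ndivides_deg0 q : q != 0 -> degv i1 q = 0%N -> ~ divides d q.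
Proof. by move=> q0 qd; apply: ndivides_deg; rewrite ?qd. Qed.

Lemma regularB x y : regular_at x -> regular_at y -> regular_at (x - y).
Proof.
move=> [u [v [dv ->]]] [u' [v' [dv' ->]]].
exists (u * v' - u' * v), (v * v'); split; first exact: ndividesM.
by rewrite fracB // ndivides_neq0.
Qed.

Lemma regular_poly x : W x -> regular_at x.
Proof. by move=> [p [q [q0 qd _ ->]]]; exists p, q; split=> //; apply: ndivides_deg0. Qed.

Lemma regularMd x : regular_at x -> regular_at (x * tofrac d).
Proof.
move=> [u [v [dv ->]]]; exists (u * d), v; split=> //.
by rewrite mulrAC -tofracM.
Qed.

(** After clearing denominators the prime [d] divides [p * v] but not [v], hence divides [p], whose
    degree in x_1 is too small unless [p = 0]. *)
Lemma poly_regular_eq0 x : W x -> regular_at (x / tofrac d) -> x = 0.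
Proof.
move=> [p [q [q0 qd pd ->]]] [u [v [dv]]]; rewrite frac_div.
move/frac_eq => E; have {}E := E (mulf_neq0 q0 irr_neq0) (ndivides_neq0 dv).
have : divides d (p * v) by exists (u * q); rewrite E mulrA mulrC.
have [_ _ dP] := mpoly_irreducible_prime d_irr.
case/dP => // dp; have [->|p0] := eqVneq p 0; first by rewrite tofrac0 mul0r.
by case: (ndivides_deg p0 pd).
Qed.

Lemma regular_split x : regular_at x ->
  exists2 w, W w & regular_at ((x - w) / tofrac d).
Proof.
move=> [u [v [dv ->]]].
(* Modulo [d] the inverse of [v] is [t / c], so [u / v] is congruent to [u * t / c]; pseudo-division
   then replaces [u * t] by [r / l]. *)
have [s [t [c [c0 cd cE]]]] := mpoly_bezout d_irr d_deg dv.
have [l [q [r [l0 ld rd lE]]]] := mpoly_pseudo_division (u * t) d_deg.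
have lc0 : l * c != 0 by apply: mulf_neq0.
have lcd : degv i1 (l * c) = 0%N by rewrite degvM // ld cd.
have v0 := ndivides_neq0 dv.
exists (tofrac r / tofrac (l * c)); first by exists r, (l * c).
exists (u * l * s + v * q), (v * (l * c)); split.
  by apply: ndividesM => //; apply: ndivides_deg0.
rewrite fracB // frac_div; apply/frac_eq; rewrite ?mulf_neq0 ?irr_neq0 //.
have -> : u * (l * c) - r * v = (u * l * s + v * q) * d.
  have -> : r = l * (u * t) - q * d by rewrite lE addrC addrA addNr add0r.
  by rewrite cE; ring.
by ring.
Qed.

Lemma divides_exhaust v : v != 0 ->
  exists N v', ~ divides d v' /\ v = d ^+ N * v'.
Proof.
have [e] := ubnP (degv i1 v); elim: e v => // e IH v le_e v0.
have [[v1 vE]|dv] := classic (divides d v); last first.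
  by exists 0%N, v; rewrite expr0 mul1r.
have v10 : v1 != 0 by apply: contraNneq v0 => v10; rewrite vE v10 mulr0.
have [|//|N [v' [dv' v'E]]] := IH v1.
  by apply: (leq_trans _ (le_e : degv i1 v <= e)%N); rewrite vE degvM ?irr_neq0 // -add1n leq_add2r.
by exists N.+1, v'; split=> //; rewrite vE v'E exprS mulrA.
Qed.

Lemma regular_exhaust x : exists N, regular_at (x * tofrac d ^+ N).
Proof.
have [u [v [v0 ->]]] := fracW x.
have [N [v' [dv' vE]]] := divides_exhaust v0.
exists N, u, v'; split=> //; rewrite -tofracXn mulrAC -tofracM.
apply/frac_eq; rewrite ?(ndivides_neq0 dv') //.
by rewrite vE; ring.
Qed.

Lemma regular_shift k x : shiftP k d = d -> regular_at x -> regular_at (shiftF k x).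
Proof.
move=> kd [u [v [dv ->]]]; exists (shiftP k u), (shiftP k v); split.
  move/(shiftP_divides (- k)); rewrite shiftPK.
  by rewrite -[X in divides (shiftP _ X)]kd shiftPK.
by rewrite shiftF_frac ?(ndivides_neq0 dv).
Qed.

Lemma inGtdE k : inGtd n d k <-> shiftP k d = d.
Proof.
rewrite /inGtd shiftF_tofrac; split=> [/eqP|->] //.
by rewrite tofrac_eq => /eqP.
Qed.

Lemma shift_divides_sym k (l : V) : divides (shiftP k d) (shiftP l d) ->
  shiftP k d = shiftP l d.
Proof.
move=> /(shiftP_divides (- k)); rewrite shiftPK -shiftPD.
move=> /(shiftP_associate irr_neq0); rewrite shiftPD => /(congr1 (shiftP k)).
by rewrite -(shiftPD k (- k)) subrr shiftP0.
Qed.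

Lemma shift_prime k p q : divides (shiftP k d) (p * q) ->
  divides (shiftP k d) p \/ divides (shiftP k d) q.
Proof.
have [_ _ dP] := mpoly_irreducible_prime d_irr.
move=> /(shiftP_divides (- k)); rewrite shiftPK (rmorphM (@shiftP K m n (- k))).
have back r : divides d (shiftP (- k) r) -> divides (shiftP k d) r.
  by move=> /(shiftP_divides k); rewrite -shiftPD subrr shiftP0.
by case/dP => /back; [left | right].
Qed.

(** Shifts of [d] are primes of the same positive degree in x_1, and one divides another only if
    they are equal. Each one found is divided out of [v], which lowers the degree. *)
Lemma shift_divisors_finite (v : P) : v != 0 -> exists l : seq P,
  (forall p, p \in l -> exists2 k : V, inG k & p = shiftP k d) /\
  (forall k : V, inG k -> divides (shiftP k d) v -> shiftP k d \in l).
Proof.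
have [e] := ubnP (degv i1 v); elim: e v => // e IH v le_e v0.
have [[k [kG [v1 vE]]]|none] := classic (exists k : V, inG k /\ divides (shiftP k d) v);
  last by exists [::]; split=> // k kG kv; case: none; exists k.
have v10 : v1 != 0 by apply: contraNneq v0 => v10; rewrite vE v10 mulr0.
have [||l [l_orb lv1]] := IH v1 => //.
  apply: (leq_trans _ (le_e : degv i1 v <= e)%N).
  by rewrite vE degvM ?shiftP_eq0 ?irr_neq0 // degv_shiftP -add1n leq_add2r.
exists (shiftP k d :: l); split=> [p|k' k'G].
  by rewrite inE => /orP[/eqP->|/l_orb]; first by exists k.
rewrite vE => /shift_prime[/shift_divides_sym->|/(lv1 _ k'G) H].
  exact: mem_head.
by rewrite inE H orbT.
Qed.

Section Digit.
Variable j : nat.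
Hypothesis j_gt0 : (0 < j)%N.

Definition pole_digit : F -> F := digit (tofrac d) W regular_at j.

Let d0 : tofrac d != 0 :> F.
Proof. by rewrite tofrac_eq0 irr_neq0. Qed.

Let W0 : W 0. Proof. exact: polyx1_deg_lt0. Qed.

Let WB x y : W x -> W y -> W (x - y). Proof. exact: polyx1_deg_ltB. Qed.

Lemma pole_digit_poly x : W (pole_digit x).
Proof.
by have [] := digitP j d0 W0 WB regularB regular_poly regular_split regular_exhaust x.
Qed.

Lemma pole_digitB x y : pole_digit (x - y) = pole_digit x - pole_digit y.
Proof.
exact: (digitB j d0 W0 WB regularB regular_poly regularMd poly_regular_eq0
  regular_split regular_exhaust).
Qed.

Lemma pole_digit_regular x : regular_at x -> pole_digit x = 0.
Proof.
exact: (digit_integral d0 j_gt0 W0 WB regularB regular_poly regularMd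
  poly_regular_eq0 regular_split regular_exhaust).
Qed.

Lemma pole_digit_pole w : W w -> pole_digit (w / tofrac d ^+ j) = w.
Proof.
exact: (digit_pole j d0 W0 WB regularB regular_poly regularMd
  poly_regular_eq0 regular_split regular_exhaust).
Qed.

Lemma pole_digit_shift k x : shiftP k d = d ->
  pole_digit (shiftF k x) = shiftF k (pole_digit x).
Proof.
move=> kd; apply: (digit_equivariant j d0 W0 WB regularB regular_poly regularMd
  poly_regular_eq0 regular_split regular_exhaust).
- by have := shiftF_tofrac k d; rewrite kd.
- by move=> y; apply: polyx1_deg_lt_shift.
- by move=> y; apply: regular_shift.
Qed.

(** The new denominator is a factor free of x_1 times a power of [shiftP k d]. The prime [d] divides
    neither, since it divides only those of its shifts that equal it. *)
Lemma pole_digit_other k w : W w -> shiftP k d <> d ->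
  pole_digit (shiftF k (w / tofrac d ^+ j)) = 0.
Proof.
move=> [p [q [q0 qd pd ->]]] kd; apply: pole_digit_regular.
rewrite -tofracXn frac_div shiftF_frac ?mulf_neq0 ?expf_neq0 ?irr_neq0 //.
exists (shiftP k p), (shiftP k (q * d ^+ j)); split=> //.
rewrite (rmorphM (@shiftP K m n k)) (rmorphXn (@shiftP K m n k)).
apply: ndividesM; first by apply: ndivides_deg0; rewrite ?shiftP_eq0 ?degv_shiftP.
have ndk : ~ divides d (shiftP k d).
  by move/(shiftP_associate irr_neq0).
elim: (j) => [|e IH]; last by rewrite exprS; apply: ndividesM.
by rewrite expr0; apply: ndivides_deg0; rewrite ?oner_eq0 ?degv1.
Qed.

(** A nonzero digit of [shiftF k x] forces [shiftP (- k) d] to divide the denominator of [x], which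
    leaves finitely many orbit points. *)
Lemma pole_digit_coverable x : exists l,
  covers (@shiftF K m n) (@inG n) (tofrac d) pole_digit l x.
Proof.
have [u [v [v0 ->]]] := fracW x.
have [l [l_orb lv]] := shift_divisors_finite v0.
exists (undup [seq tofrac p | p <- l]); split; first exact: undup_uniq.
  move=> p; rewrite mem_undup => /mapP[q /l_orb[k kG ->] ->].
  exists (- k); last by rewrite opprK shiftF_tofrac.
  by rewrite /inG mxE kG oppr0.
move=> k kG; rewrite shiftF_frac // => H.
rewrite shiftF_tofrac mem_undup; apply: map_f; apply: lv.
  by rewrite /inG mxE kG oppr0.
apply: NNPP => ndv; apply: H; apply: pole_digit_regular.
exists (shiftP k u), (shiftP k v); split=> //.
by move=> /(shiftP_divides (- k)); rewrite shiftPK.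
Qed.

End Digit.
End LocalRing.

(** * Differences and the reduction *)

Section Differences.
Variables (K : fieldType) (m n : nat).
Local Notation P := {mpoly K[m.+1]}.
Local Notation F := {fraction P}.
Local Notation V := 'rV[int]_(n.+1).
Implicit Types (k l : V) (x y : F).

Section Subgroup.
Variable S : F -> Prop.
Hypotheses (S0 : S 0) (SB : forall x y, S x -> S y -> S (x - y)).

Lemma subgroupN x : S x -> S (- x).
Proof. by rewrite -sub0r; apply: SB. Qed.

Lemma subgroupD x y : S x -> S y -> S (x + y).
Proof. by move=> xS yS; rewrite -[y]opprK; apply/SB/subgroupN. Qed.

Lemma subgroup_sum I (r : seq I) (Q : pred I) (G : I -> F) :
  (forall i, Q i -> S (G i)) -> S (\sum_(i <- r | Q i) G i).
Proof. by move=> GS; apply: big_ind => //; apply: subgroupD. Qed.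

Variable W : F -> Prop.
Hypothesis W_shift : forall k x, W x -> W (shiftF k x).

Lemma delta_add k l :
  (forall x, W x -> S (DeltaF k x)) -> (forall x, W x -> S (DeltaF l x)) ->
  forall x, W x -> S (DeltaF (k + l) x).
Proof.
move=> kS lS x xW; rewrite /DeltaF shiftFD.
rewrite -[_ - x](subrKA (shiftF l x)); apply: subgroupD; last exact: lS.
exact/kS/W_shift.
Qed.

Lemma delta_opp k :
  (forall x, W x -> S (DeltaF k x)) -> forall x, W x -> S (DeltaF (- k) x).
Proof.
move=> kS x xW; have := subgroupN (kS _ (W_shift (- k) xW)).
by rewrite /DeltaF -shiftFD subrr shiftF0 opprB.
Qed.

(** The shifts whose differences map [W] into [S] form a subgroup. This serves for the [taus]
    generating G_d and for the [sigma_x i] generating G. *)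
Lemma delta_zcomb (r : seq V) (c : nat -> int) :
  (forall i, (i < size r)%N -> forall x, W x -> S (DeltaF r`_i x)) ->
  forall x, W x -> S (DeltaF (zcomb r c) x).
Proof.
have D0 x : W x -> S (DeltaF (0 : V) x) by rewrite /DeltaF shiftF0 subrr.
move=> rS; rewrite /zcomb.
apply: (big_ind (fun k => forall x, W x -> S (DeltaF k x))) => [//||i _].
  exact: delta_add.
have {rS} := rS i (ltn_ord i); move: r`_i => k kS.
have natS e : forall x, W x -> S (DeltaF (k *+ e) x).
  elim: e => [|e IH]; first by rewrite mulr0n.
  by rewrite mulrS; apply: delta_add.
by case: (c i) => e; [apply: natS | rewrite NegzE mulrNz; apply/delta_opp/natS].
Qed.

End Subgroup.

(** Exponents of either sign become nonnegative after applying the shift [k *+ N], with [N] at least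
    every [|z i|]; [S] is stable under [k], so membership survives. *)
Lemma applyOp_laurent (S : F -> Prop) k x (r : nat) (Q : pred 'I_r)
    (c : 'I_r -> F) (z : 'I_r -> int) :
  (forall y, S y -> S (shiftF k y)) ->
  (forall i, inKt (c i)) -> {in Q &, injective z} ->
  (exists2 i, Q i & c i != 0) ->
  S (\sum_(i | Q i) c i * shiftF (k *~ z i) x) ->
  exists e, [/\ forall y, y \in e -> inKt y, has (fun y => y != 0) e
    & S (applyOp k e x)].
Proof.
move=> kS cK z_inj [i0 Qi0 ci0] xS.
pose N := (\sum_i `|z i|)%N.
have zN i : (`|z i| <= N)%N by rewrite /N (bigD1 i) //= leq_addr.
pose ix i := absz (z i + N%:Z)%R.
have ixE i : Posz (ix i) = z i + N%:Z.
  by rewrite /ix gez0_abs //; have := zN i; lia.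
have ix_lt i : (ix i < (N + N).+1)%N.
  by have := zN i; have := ixE i; lia.
pose px i := Ordinal (ix_lt i).
(* Operators do not commute with coefficients: moving the shift past [c i] shifts [c i] too. *)
pose cc i := shiftF (k *+ N) (c i).
pose e := mkseq (fun h => \sum_(i | Q i && (ix i == h)) cc i) (N + N).+1.
have eE (h : 'I_(N + N).+1) : e`_h = \sum_(i | Q i && (ix i == h)) cc i.
  by rewrite nth_mkseq.
exists e; split.
- move=> y /(nthP 0)[h]; rewrite size_mkseq => h_lt <-; rewrite nth_mkseq //.
  apply: subgroup_sum => [||i _]; [exact: inKt0 | exact: inKtB |].
  exact/inKt_shift/cK.
(* As [z] is injective on [Q], only [i0] contributes at this position and nothing cancels. *)
- apply/(has_nthP 0); exists (ix i0); first by rewrite size_mkseq ix_lt.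
  rewrite (eE (px i0)) (big_pred1 i0) => [|i].
    by rewrite /cc fmorph_eq0.
  apply/andP/eqP => [[Qi /eqP ii0]|->]; last by [].
  by apply: z_inj => //; apply: (addIr N%:Z); rewrite -!ixE; congr Posz.
have {xS} : S (shiftF (k *+ N) (\sum_(i | Q i) c i * shiftF (k *~ z i) x)).
  elim: (N) => [|h IH]; first by rewrite mulr0n shiftF0.
  by rewrite mulrS shiftFD; apply: kS.
congr S; rewrite rmorph_sum /applyOp size_mkseq (partition_big px predT) //=.
apply: eq_bigr => h _; rewrite eE mulr_suml; apply: eq_big => [i|i /andP[_ /eqP <-]].
  by rewrite -val_eqE.
rewrite rmorphM /= -shiftFD; congr (_ * shiftF _ _).
by rewrite !pmulrn -mulrzDr ixE addrC.
Qed.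

Definition x_differences x : Prop :=
  exists g : 'I_n -> F, x = \sum_(i < n) DeltaF (sigma_x i) (g i).

Lemma DeltaFB k x y : DeltaF k (x - y) = DeltaF k x - DeltaF k y.
Proof.
by rewrite /DeltaF (rmorphB (@shiftF K m n k)) /= !opprD !opprK addrACA.
Qed.

Lemma DeltaF_shift k l x : shiftF l (DeltaF k x) = DeltaF k (shiftF l x).
Proof. by rewrite /DeltaF (rmorphB (@shiftF K m n l)) /= shiftFC. Qed.

Lemma x_differences0 : x_differences 0.
Proof.
exists (fun=> 0); rewrite big1 // => i _.
by rewrite /DeltaF (rmorph0 (@shiftF K m n _)) subrr.
Qed.

Lemma x_differencesB x y :
  x_differences x -> x_differences y -> x_differences (x - y).
Proof.
move=> [g ->] [h ->]; exists (fun i => g i - h i).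
by rewrite -sumrB; apply: eq_bigr => i _; rewrite DeltaFB.
Qed.

Lemma x_differences_shift k x : x_differences x -> x_differences (shiftF k x).
Proof.
move=> [g ->]; exists (fun i => shiftF k (g i)).
by rewrite rmorph_sum; apply: eq_bigr => i _; apply: DeltaF_shift.
Qed.

Lemma sigma_x_inG (i : 'I_n) : inG (sigma_x i).
Proof. by rewrite /inG mxE. Qed.

Lemma x_differencesM c x : inKt c -> x_differences x -> x_differences (c * x).
Proof.
move=> cK [g ->]; exists (fun i => c * g i).
rewrite mulr_sumr; apply: eq_bigr => i _.
by rewrite /DeltaF rmorphM /= (inKt_fixed (sigma_x_inG i) cK) mulrBr.
Qed.

Lemma x_differences_delta k x : inG k -> x_differences (DeltaF k x).
Proof.
move=> kG; pose r := [seq sigma_x i | i <- enum 'I_n].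
(* The coefficients of [zcomb] are indexed by [nat]; [insub] supplies 0 out of range. *)
have -> : k = zcomb r (fun h => if insub h is Some i then k 0 (lift ord0 (i : 'I_n)) else 0).
  rewrite /zcomb /r size_map size_enum_ord.
  transitivity (\sum_(i < n) sigma_x i *~ k 0 (lift ord0 i)).
    apply/rowP => h; rewrite summxE.
    case: (unliftP ord0 h) => [h'|] ->.
      rewrite (bigD1 h') //= big1 ?addr0.
        by rewrite /sigma_x -scaler_int !mxE !eqxx /= mulr1 intz.
      move=> i ih; rewrite /sigma_x -scaler_int !mxE eqxx /=.
      by rewrite (inj_eq lift_inj) eq_sym (negPf ih) mulr0.
    rewrite big1; first exact: kG.
    by move=> i _; rewrite /sigma_x -scaler_int !mxE mulr0.
  apply: eq_bigr => i _; rewrite valK (nth_map i) ?size_enum_ord //.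
  by rewrite nth_ord_enum.
apply: (@delta_zcomb x_differences x_differences0 x_differencesB (fun=> True)) => //.
move=> h; rewrite size_map size_enum_ord => h_lt y _.
rewrite (nth_map (Ordinal h_lt)) ?size_enum_ord //.
set i := nth _ _ _; exists (fun i' => if i' == i then y else 0).
rewrite (bigD1 i) //= eqxx big1 ?addr0 // => i' /negPf->.
by rewrite /DeltaF (rmorph0 (@shiftF K m n _)) subrr.
Qed.

End Differences.

(** * Passing between telescopers of the fraction and operators in [tau0] on its numerator *)

Section Reduction.
Variables (K : fieldType) (m n : nat).
Local Notation P := {mpoly K[m.+1]}.
Local Notation F := {fraction P}.
Local Notation V := 'rV[int]_(n.+1).
Local Notation i1 := (ix1 m).
Variables (j : nat) (d : P) (a : F) (tau0 : V) (taus : seq V).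
Hypotheses (m_gt0 : (0 < m)%N) (j_gt0 : (0 < j)%N).
Hypotheses (d_irr : irreducible_elt d) (d_deg : (0 < degv i1 d)%N).
Local Notation W := (polyx1_deg_lt (degv i1 d)).
Hypothesis aW : W a.
Hypotheses (tau0_fix : inGtd n d tau0) (tau0_t : tau0 0 0 != 0)
  (tau0_gen : forall v, inGtd n d v -> exists c : int, inGd n d (v - tau0 *~ c))
  (taus_fix : forall i, (i < size taus)%N -> inGd n d taus`_i)
  (taus_gen : forall v, inGd n d v -> exists c, v = zcomb taus c).
Implicit Types (k l : V) (x y c : F).

Definition tau_differences x : Prop :=
  exists b : nat -> F, (forall i, (i < size taus)%N -> W (b i)) /\
    x = \sum_(i < size taus) DeltaF taus`_i (b i).

Local Notation U := tau_differences.
Local Notation D := (pole_digit d j).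
Local Notation Phi := (orbit_sum (@shiftF K m n) (@inG n) (tofrac d) D).

Let W0 : W (0 : F).
Proof. exact: polyx1_deg_lt0. Qed.

Lemma tau_differences0 : U 0.
Proof.
exists (fun=> 0); split=> [i _|]; first exact: W0.
by rewrite big1 // => i _; rewrite /DeltaF (rmorph0 (@shiftF K m n _)) subrr.
Qed.

Lemma tau_differencesB x y : U x -> U y -> U (x - y).
Proof.
move=> [b [bW ->]] [b' [b'W ->]]; exists (fun i => b i - b' i); split=> [i i_lt|].
  by apply: polyx1_deg_ltB; [apply: bW | apply: b'W].
by rewrite -sumrB; apply: eq_bigr => i _; rewrite DeltaFB.
Qed.

Lemma tau_differences_shift k x : U x -> U (shiftF k x).
Proof.
move=> [b [bW ->]]; exists (fun i => shiftF k (b i)); split=> [i i_lt|].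
  exact/polyx1_deg_lt_shift/bW.
by rewrite rmorph_sum; apply: eq_bigr => i _; apply: DeltaF_shift.
Qed.

Lemma tau_differences_delta k x : inGd n d k -> W x -> U (DeltaF k x).
Proof.
move=> /taus_gen[c ->]; move: x.
apply: (delta_zcomb tau_differences0 tau_differencesB).
  by move=> k' x; apply: polyx1_deg_lt_shift.
move=> i i_lt x xW; exists (fun h => if h == i then x else 0); split.
  by move=> h _; case: eqP => // _; apply: W0.
rewrite (bigD1 (Ordinal i_lt)) //= eqxx big1 ?addr0 // => h hi.
rewrite (_ : _ == i = false).
  by rewrite /DeltaF (rmorph0 (@shiftF K m n _)) subrr.
by apply: contraNF hi => /eqP hi; apply/eqP/val_inj.
Qed.

Let Usum := subgroup_sum tau_differences0 tau_differencesB.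

Let inGB k l : inG k -> inG l -> inG (k - l).
Proof. by rewrite /inG !mxE => -> ->; rewrite subrr. Qed.

Let inG0 : inG (0 : V).
Proof. by rewrite /inG mxE. Qed.

Let DB x y : D (x - y) = D x - D y.
Proof. exact: pole_digitB. Qed.

Let D_shift k x : inG k -> shiftF k (tofrac d) = tofrac d ->
  D (shiftF k x) = shiftF k (D x).
Proof. by move=> _ /(inGtdE d k) kd; apply: pole_digit_shift. Qed.

Let D_delta k x : inG k -> shiftF k (tofrac d) = tofrac d ->
  U (shiftF k (D x) - D x).
Proof.
by move=> kG kd; apply: tau_differences_delta; [split | apply: pole_digit_poly].
Qed.

Let sB k x y : shiftF k (x - y) = shiftF k x - shiftF k y.
Proof. exact: rmorphB. Qed.

Let coverable x : exists r : seq F,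
  covers (@shiftF K m n) (@inG n) (tofrac d) D r x.
Proof. exact: pole_digit_coverable. Qed.

Lemma PhiB x y : Phi (x - y) = Phi x - Phi y.
Proof. exact: (orbit_sumB sB DB coverable). Qed.

Lemma Phi0 : Phi 0 = 0.
Proof. by have := PhiB 0 0; rewrite !subrr. Qed.

Lemma PhiD x y : Phi (x + y) = Phi x + Phi y.
Proof. by rewrite -{1}[y]opprK -[- y]sub0r !PhiB Phi0 sub0r opprK. Qed.

Lemma Phi_sum I (r : seq I) (Q : pred I) (G : I -> F) :
  Phi (\sum_(i <- r | Q i) G i) = \sum_(i <- r | Q i) Phi (G i).
Proof. by apply: (big_morph Phi PhiD Phi0). Qed.

Lemma Phi_shift k x : inG k -> U (Phi (shiftF k x) - Phi x).
Proof.
exact: (orbit_sum_invariant (@shiftF0 K m n) (@shiftFD K m n) inG0 inGB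
  tau_differences0 tau_differencesB D_shift D_delta coverable).
Qed.

Lemma Phi_local x :
  (forall k, inG k -> shiftP k d <> d -> D (shiftF k x) = 0) ->
  U (Phi x - D x).
Proof.
move=> xD; apply: (orbit_sum_local (@shiftF0 K m n) (@shiftFD K m n) inG0
  D_shift D_delta coverable) => k kG kd.
by apply: xD => // /(inGtdE d k).
Qed.

Lemma Phi_x_differences x : x_differences n x -> U (Phi x).
Proof.
move=> [g ->]; rewrite Phi_sum; apply: Usum => i _.
by rewrite /DeltaF PhiB; apply: Phi_shift; apply: sigma_x_inG.
Qed.

(** The coefficient is carried inside the shift as [shiftF (- k) c]; it stays in K(t), so the
    numerator keeps its degree bound. *)
Lemma digit_other k c : inKt c -> shiftP k d <> d ->
  D (c * shiftF k (a / tofrac d ^+ j)) = 0.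
Proof.
move=> cK kd.
have -> : c * shiftF k (a / tofrac d ^+ j) =
    shiftF k (shiftF (- k) c * a / tofrac d ^+ j).
  by rewrite -[shiftF _ c * a * _]mulrA [RHS](rmorphM (@shiftF K m n k)) /= -shiftFD subrr shiftF0.
by apply: pole_digit_other => //; apply/polyx1_deg_lt_inKt/aW/inKt_shift.
Qed.

Lemma shift_fix k x : shiftF k (tofrac d) = tofrac d ->
  shiftF k (x / tofrac d ^+ j) = shiftF k x / tofrac d ^+ j.
Proof. by move=> kd; rewrite fmorph_div rmorphXn /= kd. Qed.

Lemma tau0_mulz_fix (q : int) : shiftF (tau0 *~ q) (tofrac d) = tofrac d.
Proof.
have nat e : shiftF (tau0 *+ e) (tofrac d) = tofrac d.
  elim: e => [|e IH]; first by rewrite mulr0n shiftF0.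
  by rewrite mulrS shiftFD IH.
case: q => e; first exact: nat.
by rewrite NegzE mulrNz -{1}(nat e.+1) -shiftFD addNr shiftF0.
Qed.

Lemma mulz_coord k (q : int) : (k *~ q : V) 0 0 = (k 0 0 * q)%R.
Proof. by rewrite -scaler_int mxE intz mulrC. Qed.

Lemma coordD k l : (k + l) 0 0 = k 0 0 + l 0 0.
Proof. by rewrite mxE. Qed.

Lemma coordB k l : (k - l) 0 0 = k 0 0 - l 0 0.
Proof. by rewrite !mxE. Qed.

Lemma sigma_t_coord : (sigma_t n) 0 0 = 1.
Proof. by rewrite mxE. Qed.

(** Composing with an element of G keeps the t-exponent [z]. A composite fixing [d] would be a
    multiple of [tau0] modulo G_d, making [z] a multiple of the t-exponent of [tau0]. Hence every
    digit vanishes. *)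
Lemma Phi_term_other c (z : int) : inKt c -> ~~ (tau0 0%R 0%R %| z)%Z ->
  U (Phi (c * shiftF (sigma_t n *~ z) (a / tofrac d ^+ j))).
Proof.
move=> cK kz; set y := c * _.
have Dy k : inG k -> D (shiftF k y) = 0.
  move=> kG; rewrite /y (rmorphM (@shiftF K m n k)) /= -shiftFD.
  apply: digit_other; first exact: inKt_shift.
  move=> /(inGtdE d) /tau0_gen[q []]; rewrite /inG => /eqP.
  rewrite coordB coordD !mulz_coord kG sigma_t_coord add0r mul1r.
  rewrite subr_eq0 => /eqP zE; case/negP: kz.
  by rewrite zE; apply: dvdz_mulr.
have := Phi_local (fun k kG _ => Dy k kG).
by have := Dy 0 inG0; rewrite shiftF0 => ->; rewrite subr0.
Qed.

(** The shift [theta] lies in G and turns the term into [w / d ^+ j], because [tau0] fixes [d].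
    Invariance of [Phi] under G then reduces the claim to the digit [w]. *)
Lemma Phi_term c (q : int) : inKt c ->
  U (Phi (c * shiftF (sigma_t n *~ (tau0 0 0 * q)) (a / tofrac d ^+ j))
     - c * shiftF (tau0 *~ q) a).
Proof.
move=> cK; set y := c * shiftF _ (_ / _).
pose theta := tau0 *~ q - sigma_t n *~ (tau0 0 0 * q).
have thetaG : inG theta.
  by rewrite /inG coordB !mulz_coord sigma_t_coord mul1r subrr.
pose w := c * shiftF (tau0 *~ q) a.
have wW : W w by apply/polyx1_deg_lt_inKt/polyx1_deg_lt_shift.
have yE : shiftF theta y = w / tofrac d ^+ j.
  rewrite /y (rmorphM (@shiftF K m n theta)) /= (inKt_fixed thetaG cK).
  by rewrite -shiftFD subrK shift_fix ?tau0_mulz_fix // mulrA.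
have := tau_differencesB (Phi_local (x := shiftF theta y) _) (Phi_shift y thetaG).
rewrite opprB addrC addrA subrK yE pole_digit_pole //; apply.
by move=> k kG kd; apply: pole_digit_other.
Qed.

Lemma telescoper_reduction (e : seq F) :
  is_telescoper n e (a / tofrac d ^+ j) ->
  exists ell, [/\ forall y, y \in ell -> inKt y, has (fun y => y != 0) ell
    & U (applyOp tau0 ell a)].
Proof.
set f := a / _ => -[eK /(has_nthP 0)[b b_lt eb] ef].
(* This translation moves a nonzero coefficient to exponent 0, which is divisible by the t-exponent
   of [tau0], so that coefficient survives the selection [Q]. *)
pose s := sigma_t n *~ - b%:Z.
have eiK (i : 'I_(size e)) : inKt e`_i by apply/eK/mem_nth.
pose c (i : 'I_(size e)) := shiftF s e`_i.
have cK i : inKt (c i) by apply: inKt_shift.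
pose Q (i : 'I_(size e)) := (tau0 0%R 0%R %| i%:Z - b%:Z)%Z.
pose z (i : 'I_(size e)) := ((i%:Z - b%:Z) %/ tau0 0%R 0%R)%Z.
have zE i : Q i -> i%:Z - b%:Z = tau0 0 0 * z i by move=> Qi; rewrite mulrC divzK.
pose y (i : 'I_(size e)) := c i * shiftF (sigma_t n *~ (i%:Z - b%:Z)) f.
have yE : shiftF s (applyOp (sigma_t n) e f) = \sum_i y i.
  rewrite rmorph_sum; apply: eq_bigr => i _.
  rewrite (rmorphM (@shiftF K m n s)) /= -shiftFD; congr (_ * shiftF _ _).
  by rewrite pmulrn -mulrzDr addrC.
have Uy : U (\sum_i Phi (y i)).
  by rewrite -Phi_sum -yE; apply/Phi_x_differences/x_differences_shift.
apply: (applyOp_laurent (Q := Q) (c := c) (z := z)) => //.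
- by move=> x; apply: tau_differences_shift.
- move=> i h Qi Qh zih; apply: val_inj; apply/eqP.
  have : i%:Z - b%:Z == h%:Z - b%:Z by rewrite !zE // zih.
  by rewrite (inj_eq (addIr _)) eqz_nat.
- exists (Ordinal b_lt); first by rewrite /Q /= subrr dvdz0.
  by rewrite /c fmorph_eq0.
(* All three sums on the right lie in [U]: the first by the telescoper relation, the others by
   [Phi_term_other] and [Phi_term]. *)
have -> : \sum_(i | Q i) c i * shiftF (tau0 *~ z i) a = \sum_i Phi (y i)
    - \sum_(i | ~~ Q i) Phi (y i)
    - \sum_(i | Q i) (Phi (y i) - c i * shiftF (tau0 *~ z i) a).
  rewrite [\sum_i Phi (y i)](bigID Q) /= addrK.
  by rewrite [X in _ - X]sumrB opprB addrC subrK.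
apply: tau_differencesB; first apply: tau_differencesB => //.
  by apply: Usum => i; apply: Phi_term_other.
by apply: Usum => i Qi; rewrite /y zE //; apply: Phi_term.
Qed.

Lemma telescoper_lift (ell : seq F) :
  (forall y, y \in ell -> inKt y) -> has (fun y => y != 0) ell ->
  U (applyOp tau0 ell a) -> has_telescoper n (a / tofrac d ^+ j).
Proof.
set f := a / _ => ellK ell0 [b [_ bE]].
have liK (i : 'I_(size ell)) : inKt ell`_i by apply/ellK/mem_nth.
have Xsum := subgroup_sum (@x_differences0 K m n) (@x_differencesB K m n).
have Lf : x_differences n (applyOp tau0 ell f).
  (* Since [tau0] and the [taus] fix [d], the relation for [a] may be divided by [d ^+ j]. *)
  have -> : applyOp tau0 ell f =
      \sum_(i < size taus) DeltaF taus`_i (b i / tofrac d ^+ j).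
    transitivity (applyOp tau0 ell a / tofrac d ^+ j).
      rewrite /applyOp mulr_suml; apply: eq_bigr => i _.
      by rewrite pmulrn shift_fix ?tau0_mulz_fix // mulrA.
    rewrite bE mulr_suml; apply: eq_bigr => i _.
    have [_ id] := taus_fix (ltn_ord i).
    by rewrite /DeltaF shift_fix // mulrBl.
  apply: Xsum => i _; apply: x_differences_delta.
  by have [] := taus_fix (ltn_ord i).
pose z (i : 'I_(size ell)) := tau0 0 0 * i%:Z.
have [|||||e [eK e0 [g gE]]] := @applyOp_laurent _ _ _ (@x_differences K m n)
  (sigma_t n) f (size ell) predT (fun i => ell`_i) z.
- by move=> y; apply: x_differences_shift.
- exact: liK.
- by move=> i h _ _ /(mulfI tau0_t) [] /val_inj.
- by have /(has_nthP 0)[i i_lt li] := ell0; exists (Ordinal i_lt).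
(* The shifts [tau0 *+ i] and [sigma_t n *~ z i] have the same t-exponent, so they differ by an
   element of G and the correction is a sum of x-differences. *)
- have -> : \sum_(i < size ell) ell`_i * shiftF (sigma_t n *~ z i) f =
      applyOp tau0 ell f - \sum_(i < size ell) ell`_i * DeltaF (tau0 *+ i - sigma_t n *~ z i)
                             (shiftF (sigma_t n *~ z i) f).
    rewrite -sumrB; apply: eq_bigr => i _.
    by rewrite /DeltaF -shiftFD subrK mulrBr opprB addrC subrK.
  apply: x_differencesB => //; apply: Xsum => i _.
  apply: x_differencesM => //; apply: x_differences_delta.
  by rewrite /inG coordB pmulrn !mulz_coord sigma_t_coord mul1r subrr.
by exists e; split=> //; exists g.
Qed.

End Reduction.

Theorem theorem1p4
  (K : fieldType) (HK : [pchar K] =i pred0)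
  (m n : nat) (Hn1 : (1 <= n)%N) (Hnm : (n <= m)%N)
  (j : nat) (Hj : (1 <= j)%N)
  (d : {mpoly K[m.+1]}) (a f : {fraction {mpoly K[m.+1]}})
  (Hd_irr : irreducible_elt d)
  (Hd_deg : (0 < degv (ix1 m) d)%N)
  (Ha : polyx1_deg_lt (degv (ix1 m) d) a)
  (Hf : f = a / (tofrac d) ^+ j)
  (Hrank : quot_rank1 (inGtd n d) (inGd n d))
  (tau0 : 'rV[int]_(n.+1)) (taus : seq 'rV[int]_(n.+1))
  (Hcoset : inGtd n d tau0 /\
            forall v, inGtd n d v -> exists c : int, inGd n d (v - tau0 *~ c))
  (Hbasis :
     ((exists2 v, inGd n d v & v != 0) /\
        is_basis (tau0 :: taus) (inGtd n d) /\ is_basis taus (inGd n d))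
     \/
     ((forall v, inGd n d v -> v = 0) /\ taus = [:: 0] /\
        is_basis [:: tau0] (inGtd n d))) :
  has_telescoper n f <->
  exists ell : seq {fraction {mpoly K[m.+1]}},
    [/\ (forall c, c \in ell -> inKt c), has (fun c => c != 0) ell &
      exists b : nat -> {fraction {mpoly K[m.+1]}},
        (forall i, (i < size taus)%N -> polyx1_deg_lt (degv (ix1 m) d) (b i)) /\
        applyOp tau0 ell a = \sum_(i < size taus) DeltaF taus`_i (b i)].
Proof.
have m_gt0 : (0 < m)%N by apply: leq_trans Hnm.
have [tau0_fix tau0_gen] := Hcoset.
have zero_fix : inGd n d (0 : 'rV[int]_(n.+1)).
  by split; [rewrite /inG mxE | rewrite /inGtd shiftF0].
have [taus_fix taus_gen] : (forall i, (i < size taus)%N -> inGd n d taus`_i) /\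
    (forall v, inGd n d v -> exists c, v = zcomb taus c).
  case: Hbasis => [[_ [_ []]]|[Gd0 [-> _]]] //.
  (* For trivial G_d the list [[:: 0]] is not a basis, but it still generates G_d. *)
  split=> [[|i]|v /Gd0->] //; by exists (fun=> 0); rewrite /zcomb big1.
(* Otherwise [tau0] lies in G and G_{t,d} equals G_d, which contradicts the infinite order of [g]
   modulo G_d. *)
have tau0_t : tau0 0 0 != 0.
  apply/eqP => t0; have [g gd [g_inf _]] := Hrank.
  have [c [gc _]] := tau0_gen _ gd.
  suff /g_inf : inGd n d (g *~ 1) by [].
  split; rewrite mulr1z //.
  by move: gc; rewrite /inG coordB mulz_coord t0 mul0r subr0.
rewrite Hf; split=> [[e]|[ell [ellK ell0 bE]]].
  exact: telescoper_reduction.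
exact: (telescoper_lift j tau0_fix tau0_t taus_fix ellK ell0 bE).
Qed.
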